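(* Let $\Lambda$ be a hereditary artin algebra. Then the assignments $U\mapsto \mathsf{cok}\,U$ and $\mathcal{C}\mapsto P(\mathcal{C})$ give mutually inverse bijections $$\mathsf{cok}\colon \mathsf{rigid}\,\Lambda \rightleftarrows \mathsf{ice_p}\,\Lambda \colon P$$ between the set $\mathsf{rigid}\,\Lambda$ of isomorphism classes of basic rigid $\Lambda$-modules and the set $\mathsf{ice_p}\,\Lambda$ of ICE-closed subcategories of $\mathsf{mod}\,\Lambda$ with enough $\operatorname{Ext}$-projectives. Moreover, if $\Lambda$ is representation-finite, then every CE-closed subcategory of $\mathsf{mod}\,\Lambda$ is automatically ICE-closed, and $\mathsf{ice_p}\,\Lambda=\mathsf{ice}\,\Lambda$ holds, where $\mathsf{ice}\,\Lambda$ is the set of all ICE-closed subcategories of $\mathsf{mod}\,\Lambda$.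
   Context: An artin algebra is an algebra over a commutative artinian ring $R$ which is finitely generated as an $R$-module. $\mathsf{mod}\,\Lambda$ is the category of finitely generated right $\Lambda$-modules; all modules are finitely generated right modules. $\Lambda$ is representation-finite if $\mathsf{mod}\,\Lambda$ has finitely many indecomposables up to isomorphism. All subcategories are assumed to be full and closed under isomorphisms, direct sums and direct summands. $\mathsf{add}\,U$ is the subcategory of direct summands of finite direct sums of copies of $U$. A module is basic if it is a direct sum of pairwise non-isomorphic indecomposables (the zero module is basic). $U$ is rigid if $\operatorname{Ext}^1_\Lambda(U,U)=0$. $\mathsf{cok}\,U$ is the subcategory of $\mathsf{mod}\,\Lambda$ consisting of cokernels of maps in $\mathsf{add}\,U$. A subcategory $\mathcal{C}$ of $\mathsf{mod}\,\Lambda$ is closed under extensions if for every short exact sequence $0\to L\to M\to N\to 0$ with $L,N\in\mathcal{C}$ one has $M\in\mathcal{C}$; it is closed under cokernels (resp. images) if for every map $f$ between objects of $\mathcal{C}$ one has $\operatorname{coker}f\in\mathcal{C}$ (resp. $\operatorname{im}f\in\mathcal{C}$). $\mathcal{C}$ is ICE-closed if it is closed under images, cokernels and extensions, and CE-closed if it is closed under cokernels and extensions. For an extension-closed subcategory $\mathcal{C}$, an object $X\in\mathcal{C}$ is $\operatorname{Ext}$-projective in $\mathcal{C}$ if $\operatorname{Ext}^1_\Lambda(X,C)=0$ for all $C\in\mathcal{C}$. $\mathcal{C}$ has enough $\operatorname{Ext}$-projectives if for every $X\in\mathcal{C}$ there is a short exact sequence $0\to Y\to P\to X\to 0$ with $P$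 $\operatorname{Ext}$-projective in $\mathcal{C}$ and $Y\in\mathcal{C}$. An object $P\in\mathcal{C}$ is an $\operatorname{Ext}$-progenerator of $\mathcal{C}$ if $\mathsf{add}\,P$ is exactly the class of $\operatorname{Ext}$-projective objects in $\mathcal{C}$ and $\mathcal{C}$ has enough $\operatorname{Ext}$-projectives. $P(\mathcal{C})$ denotes the basic $\operatorname{Ext}$-progenerator of $\mathcal{C}$, unique up to isomorphism; that it exists for every $\mathcal{C}\in\mathsf{ice_p}\,\Lambda$ is part of the assertion. *)

(* Defs.v *)
From HB Require Import structures.
From mathcomp Require Import all_boot all_algebra.
From Stdlib Require Import FunctionalExtensionality PropExtensionality.

Set Implicit Arguments.
Unset Strict Implicit.
Unset Printing Implicit Defensive.

Import GRing.Theory.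
Local Open Scope ring_scope.

(* Right modules over L are left modules over the converse ring L^c.  The base
   structures are the [pz] ones, so that the zero algebra is not excluded. *)
Notation rmodType L := (lmodType L^c).

(** * Artin algebras *)

Definition is_ideal (R : comPzRingType) (I : R -> Prop) : Prop :=
  [/\ I 0, (forall x y, I x -> I y -> I (x + y))
    & (forall a x, I x -> I (a * x))].

Definition artinian (R : comPzRingType) : Prop :=
  forall I : nat -> R -> Prop,
    (forall n, is_ideal (I n)) -> (forall n x, I n.+1 x -> I n x) ->
    exists N : nat, forall n : nat, (N <= n)%N -> forall x, I n x <-> I N x.

(* The R-algebra structure of L is given by a ring morphism from R to the
   center of L ([algType R] would force L to be nonzero). *)
Definition artin_algebra (R : comPzRingType) (L : pzRingType)
    (phi : {rmorphism R -> L}) : Prop :=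
  [/\ artinian R,
      (forall (a : R) (x : L), phi a * x = x * phi a)
    & exists (n : nat) (g : 'I_n -> L), forall x : L,
        exists c : 'I_n -> R, x = \sum_i phi (c i) * g i].

(** * Modules *)

Definition fin_gen (S : pzRingType) (M : lmodType S) : Prop :=
  exists (n : nat) (g : 'I_n -> M), forall x : M,
    exists c : 'I_n -> S, x = \sum_i c i *: g i.

Record fgmod (L : pzRingType) := FGMod {
  fgmod_sort :> rmodType L;
  fgmod_fin_gen : fin_gen fgmod_sort
}.

Definition surj (A B : Type) (f : A -> B) : Prop := forall y, exists x, f x = y.

Definition mod_iso (S : pzRingType) (M N : lmodType S) : Prop :=
  exists f : {linear M -> N}, bijective f.

Definition is_zero (S : pzRingType) (M : lmodType S) : Prop :=
  forall x : M, x = 0.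

Definition exact_at (S : pzRingType) (A B C : lmodType S)
    (f : {linear A -> B}) (g : {linear B -> C}) : Prop :=
  forall y : B, g y = 0 <-> exists x : A, f x = y.

Definition short_exact (S : pzRingType) (A B C : lmodType S)
    (f : {linear A -> B}) (g : {linear B -> C}) : Prop :=
  [/\ injective f, exact_at f g & surj g].

Definition is_cokernel (S : pzRingType) (A B M : lmodType S)
    (f : {linear A -> B}) : Prop :=
  exists2 p : {linear B -> M}, exact_at f p & surj p.

Definition is_image (S : pzRingType) (A B M : lmodType S)
    (f : {linear A -> B}) : Prop :=
  exists (p : {linear A -> M}) (i : {linear M -> B}),
    [/\ surj p, injective i & forall x, f x = i (p x)].

(* M is the direct sum of the finite family X, as a biproduct; for n = 0 this
   says that M is zero. *)
Definition is_dirsum (S : pzRingType) (n : nat) (X : 'I_n -> lmodType S)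
    (M : lmodType S) : Prop :=
  exists (inj : forall i, {linear X i -> M})
         (proj : forall i, {linear M -> X i}),
    [/\ (forall i x, proj i (inj i x) = x),
        (forall i j, i != j -> forall x, proj j (inj i x) = 0)
      & (forall m, m = \sum_i inj i (proj i m))].

Definition is_summand (S : pzRingType) (A M : lmodType S) : Prop :=
  exists B : lmodType S, mod_iso M (A * B)%type.

Definition indecomposable (S : pzRingType) (M : lmodType S) : Prop :=
  ~ is_zero M /\
  (forall A B : lmodType S, mod_iso M (A * B)%type -> is_zero A \/ is_zero B).

Definition projective (S : pzRingType) (P : lmodType S) : Prop :=
  forall (M N : lmodType S) (g : {linear M -> N}) (h : {linear P -> N}),
    surj g -> exists k : {linear P -> M}, forall x, g (k x) = h x.

(* Every right ideal is projective.  For artin algebras being right hereditary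
   is the same as being left hereditary. *)
Definition hereditary (L : pzRingType) : Prop :=
  forall (I : rmodType L) (i : {linear I -> (L^c)^o}),
    injective i -> projective I.

(** * Ext^1 and rigid modules *)

Record extension (S : pzRingType) (X C : lmodType S) := Extension {
  ext_mid : lmodType S;
  ext_inc : {linear C -> ext_mid};
  ext_proj : {linear ext_mid -> X};
  ext_exact : short_exact ext_inc ext_proj
}.

Definition ext_equiv (S : pzRingType) (X C : lmodType S)
    (E E' : extension X C) : Prop :=
  exists f : {linear ext_mid E -> ext_mid E'},
    [/\ bijective f, (forall c, f (ext_inc E c) = ext_inc E' c)
      & (forall e, ext_proj E' (f e) = ext_proj E e)].

(* Ext^1(X, C) is the set of equivalence classes of extensions of X by C; it
   always contains the split class, so it vanishes when there is no other. *)
Definition Ext1_eq0 (S : pzRingType) (X C : lmodType S) : Prop :=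
  forall E E' : extension X C, ext_equiv E E'.

Definition rigid (L : pzRingType) (U : fgmod L) : Prop := Ext1_eq0 U U.

Definition basic (L : pzRingType) (U : fgmod L) : Prop :=
  exists (n : nat) (X : 'I_n -> fgmod L),
    [/\ (forall i, indecomposable (X i)),
        (forall i j, i != j -> ~ mod_iso (X i) (X j))
      & is_dirsum (fun i => fgmod_sort (X i)) U].

Definition rep_finite (L : pzRingType) : Prop :=
  exists (n : nat) (X : 'I_n -> fgmod L),
    forall M : fgmod L, indecomposable M -> exists i, mod_iso M (X i).

(** * Subcategories of the category of finitely generated right modules *)

(* A full subcategory is given by its class of objects. *)
Definition subcat (L : pzRingType) := fgmod L -> Prop.

(* The standing assumption on subcategories.  The empty direct sum is a
   direct sum, so a subcategory contains the zero modules. *)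
Definition subcategory (L : pzRingType) (C : subcat L) : Prop :=
  [/\ (forall M N : fgmod L, C M -> mod_iso M N -> C N),
      (forall (n : nat) (X : 'I_n -> fgmod L) (M : fgmod L),
         (forall i, C (X i)) -> is_dirsum (fun i => fgmod_sort (X i)) M -> C M)
    & (forall A M : fgmod L, C M -> is_summand A M -> C A)].

Definition ext_closed (L : pzRingType) (C : subcat L) : Prop :=
  forall (A B D : fgmod L) (f : {linear A -> B}) (g : {linear B -> D}),
    short_exact f g -> C A -> C D -> C B.

Definition coker_closed (L : pzRingType) (C : subcat L) : Prop :=
  forall (A B M : fgmod L) (f : {linear A -> B}),
    C A -> C B -> is_cokernel M f -> C M.

Definition im_closed (L : pzRingType) (C : subcat L) : Prop :=
  forall (A B M : fgmod L) (f : {linear A -> B}),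
    C A -> C B -> is_image M f -> C M.

Definition add_of (L : pzRingType) (U : fgmod L) : subcat L :=
  fun M => exists (n : nat) (T : fgmod L),
    is_dirsum (fun _ : 'I_n => fgmod_sort U) T /\ is_summand M T.

Definition cok (L : pzRingType) (U : fgmod L) : subcat L :=
  fun M => exists (A B : fgmod L) (f : {linear A -> B}),
    [/\ add_of U A, add_of U B & is_cokernel M f].

Definition ext_projective (L : pzRingType) (C : subcat L) : subcat L :=
  fun X => C X /\ forall Y, C Y -> Ext1_eq0 X Y.

Definition enough_ext_projectives (L : pzRingType) (C : subcat L) : Prop :=
  forall X, C X ->
    exists (Y P : fgmod L) (f : {linear Y -> P}) (g : {linear P -> X}),
      [/\ short_exact f g, ext_projective C P & C Y].

Definition ext_progenerator (L : pzRingType) (C : subcat L) : subcat L :=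
  fun P => [/\ C P, add_of P = ext_projective C & enough_ext_projectives C].

(** * The two sets and the two assignments *)

Definition iso_class (L : pzRingType) (U : fgmod L) : subcat L :=
  fun V => mod_iso U V.

Definition rigid_classes (L : pzRingType) : subcat L -> Prop :=
  fun K => exists U : fgmod L, [/\ basic U, rigid U & K = iso_class U].

Definition ce (L : pzRingType) : subcat L -> Prop :=
  fun C => [/\ subcategory C, coker_closed C & ext_closed C].

Definition ice (L : pzRingType) : subcat L -> Prop :=
  fun C => [/\ subcategory C, im_closed C, coker_closed C & ext_closed C].

Definition ice_p (L : pzRingType) : subcat L -> Prop :=
  fun C => ice C /\ enough_ext_projectives C.

(* The map induced by [cok] on isomorphism classes, see [cok_class_iso]. *)
Definition cok_class (L : pzRingType) (K : subcat L) : subcat L :=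
  fun M => exists2 U, K U & cok U M.

(* The collection of all basic Ext-progenerators of C.  That P(C) exists and is
   unique up to isomorphism means that this is a single isomorphism class. *)
Definition progen_class (L : pzRingType) (C : subcat L) : subcat L :=
  fun P => basic P /\ ext_progenerator C P.

Lemma mod_iso_inv (S : pzRingType) (M N : lmodType S) :
  mod_iso M N ->
  exists (f : {linear M -> N}) (g : {linear N -> M}), cancel f g /\ cancel g f.
Proof.
case=> f [g fK gK].
have lin_g : linear g.
  by move=> a u v; apply: (can_inj fK); rewrite linearP !gK.
pose G := GRing.isLinear.Build S N M *:%R g lin_g.
by exists f, (HB.pack g G : {linear N -> M}).
Qed.

Lemma mod_iso_sym (S : pzRingType) (M N : lmodType S) :
  mod_iso M N -> mod_iso N M.
Proof. by case/mod_iso_inv=> f [g [fK gK]]; exists g; exists f. Qed.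

Lemma add_of_iso (L : pzRingType) (U V M : fgmod L) :
  mod_iso U V -> add_of U M -> add_of V M.
Proof.
case/mod_iso_inv=> f [g [fK gK]].
case=> n [T [[i [p [ip0 ip1 ip2]]] sMT]]; exists n, T; split=> //.
exists (fun k => (i k \o g)%FUN : {linear V -> T}),
       (fun k => (f \o p k)%FUN : {linear T -> V}).
split=> [k x|k l kl x|m] /=.
- by rewrite ip0 gK.
- by rewrite ip1 // linear0.
- by rewrite {1}[m]ip2; apply: eq_bigr => k _; rewrite fK.
Qed.

Lemma cok_class_iso (L : pzRingType) (U : fgmod L) :
  cok_class (iso_class U) = cok U.
Proof.
apply: functional_extensionality => M; apply: propositional_extensionality.
split; last first.
  by move=> cM; exists U => //; exists (idfun : {linear U -> U}); exists id.
case=> V /mod_iso_sym iVU [A [B [f [aA aB cM]]]].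
by exists A, B, f; split=> //; apply: add_of_iso iVU _.
Qed.

(* Main.v *)
(* Let U be rigid over a hereditary algebra and let I be the image of a map in
   add U.  As I is a quotient of an object of add U, Ext(U, I) = 0; the kernel K
   of a right add U-approximation of I satisfies Ext(U, K) = 0, hence
   Ext(I, K) = 0 since I is also a submodule of an object of add U.  So the
   approximation splits and I is in add U.  Hence every object X of cok U has a
   resolution 0 -> U1 -> U0 -> X -> 0 in add U; lifting maps X -> Y to the terms
   U0 gives all closure properties, and add U is the class of Ext-projectives.
   Conversely, let C be ICE-closed with enough Ext-projectives.  By the
   Happel-Ringel lemma the matrix of the lengths of Hom(X_i, X_j), for pairwise
   non-isomorphic indecomposable Ext-projectives X_i, is invertible, and it
   factors through the Grothendieck group of projectives; so there are finitely
   many X_i, and their sum P satisfies cok P = C.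
   If C is covariantly finite and closed under extensions, pushing out a
   presentation of X in C along a minimal left C-approximation of the syzygy
   yields a short exact sequence in C that ends in X and has an Ext-projective
   middle term, which settles the representation-finite case. *)
From HB Require Import structures.
From mathcomp Require Import all_boot all_algebra.
From mathcomp Require Import boolp functions.
Require Import Defs.

Set Implicit Arguments.
Unset Strict Implicit.
Unset Printing Implicit Defensive.

Import GRing.Theory.
Local Open Scope ring_scope.

(** * Submodules and quotients *)

(** Ext is given by extensions alone, without derived functors, so each vanishing statement is
    turned into one about maps: sections of extensions, lifts out of [X], or extensions of maps from
    a syzygy. Long exact sequences become diagram chases on a presentation [0 -> K -> F -> X -> 0]
    with [K] projective, the point where heredity acts; to get it, the hypothesis on right ideals is
    carried over to submodules of finite free modules. The other base is length over [R], for
    modules and Hom groups alike. The descending chain condition on [R] has to be converted into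
    finite length; from this come finite generation of kernels, images and Hom groups, hence
    approximations, and Fitting's lemma, hence Krull-Schmidt. Over a representation-finite algebra a
    CE-closed [C] becomes ICE-closed indirectly: it has an Ext-progenerator [P], closure under
    cokernels gives [C = cok P], and [cok P] is closed under images because [P] is rigid. *)

Definition lin_of (S : pzRingType) (M N : lmodType S) (f : M -> N)
    (lf : linear f) : {linear M -> N} :=
  HB.pack f (GRing.isLinear.Build S M N *:%R f lf).

Definition submod (S : pzRingType) (M : lmodType S) (P : M -> Prop) : Prop :=
  P 0 /\ forall a x y, P x -> P y -> P (a *: x + y).

(** Linear maps without an explicit formula are obtained from their graphs: choice selects the
    values, and uniqueness of the value forces linearity. *)
Lemma linear_rel (S : pzRingType) (M N : lmodType S) (r : M -> N -> Prop) :
  (forall x, exists y, r x y) ->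
  (forall x y y', r x y -> r x y' -> y = y') ->
  (forall a x y x' y', r x y -> r x' y' -> r (a *: x + x') (a *: y + y')) ->
  exists f : {linear M -> N}, forall x, r x (f x).
Proof.
move=> /choice[f rf] r_uniq r_lin.
have lf : linear f.
  by move=> a x y; apply: (r_uniq (a *: x + y)) => //; apply: r_lin.
by exists (lin_of lf).
Qed.

Lemma factor_surj (S : pzRingType) (M Q N : lmodType S) (p : {linear M -> Q})
    (f : {linear M -> N}) :
  surj p -> (forall x, p x = 0 -> f x = 0) ->
  exists g : {linear Q -> N}, forall x, g (p x) = f x.
Proof.
move=> sp pf.
have eqf x y : p x = p y -> f x = f y.
  move=> pxy; apply/eqP; rewrite -subr_eq0 -linearB pf // linearB pxy.
  exact: subrr.
have [|||g gP] := @linear_rel S Q N (fun z y => exists2 x, p x = z & f x = y).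
- by move=> z; have [x xz] := sp z; exists (f x), x.
- by move=> z _ _ [x xz <-] [y yz <-]; apply: eqf; rewrite xz.
- move=> a z _ z' _ [x <- <-] [x' <- <-]; exists (a *: x + x');
    by rewrite linearP.
by exists g => x; have [y yx <-] := gP (p x); apply: eqf.
Qed.

Lemma factor_inj (S : pzRingType) (N M X : lmodType S) (i : {linear N -> M})
    (f : {linear X -> M}) :
  injective i -> (forall x, exists y, i y = f x) ->
  exists g : {linear X -> N}, forall x, i (g x) = f x.
Proof.
move=> inj_i fi; apply: (@linear_rel S X N (fun x y => i y = f x)) => //.
  by move=> x y y' <- /inj_i.
by move=> a x y x' y' e e'; rewrite !linearP e e'.
Qed.

Section Submodules.
Variables (S : pzRingType) (M : lmodType S) (P : M -> Prop).
Hypothesis subP : submod P.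

Lemma submod0 : P 0. Proof. by case: subP. Qed.
Lemma submodZ a x : P x -> P (a *: x).
Proof. by move=> Px; case: subP => P0 /(_ a x 0 Px P0); rewrite addr0. Qed.
Lemma submodD x y : P x -> P y -> P (x + y).
Proof. by move=> Px Py; case: subP => _ /(_ 1 x y Px Py); rewrite scale1r. Qed.
Lemma submodN x : P x -> P (- x).
Proof. by move=> Px; rewrite -scaleN1r; apply: submodZ. Qed.
Lemma submodB x y : P x -> P y -> P (x - y).
Proof. by move=> Px Py; apply: submodD => //; apply: submodN. Qed.
Lemma submod_sum n (f : 'I_n -> M) : (forall i, P (f i)) -> P (\sum_i f i).
Proof.
by move=> Pf; apply: (big_ind P) => //; [apply: submod0 | apply: submodD].
Qed.

Definition subm of submod P := {x : M | `[<P x>]}.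
Local Notation N := (subm subP).
HB.instance Definition _ := SubType.on N.
HB.instance Definition _ := Choice.on N.

Let mk x (Px : P x) : N := exist _ x (asboolT Px).
Let valP' (x : N) : P (val x). Proof. exact/asboolP/(valP x). Qed.
Let add (x y : N) := mk (submodD (valP' x) (valP' y)).
Let opp (x : N) := mk (submodN (valP' x)).
Let scale a (x : N) := mk (submodZ a (valP' x)).
Let addA : associative add.
Proof. by move=> x y z; apply: val_inj; rewrite /= addrA. Qed.
Let addC : commutative add.
Proof. by move=> x y; apply: val_inj; rewrite /= addrC. Qed.
Let add0 : left_id (mk submod0) add.
Proof. by move=> x; apply: val_inj; rewrite /= add0r. Qed.
Let addN : left_inverse (mk submod0) opp add.
Proof. by move=> x; apply: val_inj; rewrite /= addNr. Qed.
HB.instance Definition _ := GRing.isZmodule.Build N addA addC add0 addN.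
Let scaleA a b (x : N) : scale a (scale b x) = scale (a * b) x.
Proof. by apply: val_inj; rewrite /= scalerA. Qed.
Let scale1 : left_id 1 scale.
Proof. by move=> x; apply: val_inj; rewrite /= scale1r. Qed.
Let scaleDr : right_distributive scale +%R.
Proof. by move=> a x y; apply: val_inj; rewrite /= scalerDr. Qed.
Let scaleDl (v : N) : {morph scale^~ v : a b / a + b}.
Proof. by move=> a b; apply: val_inj; rewrite /= scalerDl. Qed.
HB.instance Definition _ :=
  GRing.Zmodule_isLmodule.Build S N scaleA scale1 scaleDr scaleDl.

Lemma submodule_ex : exists (N : lmodType S) (i : {linear N -> M}),
  injective i /\ forall x, P x <-> exists y, i y = x.
Proof.
have lv : linear (val : N -> M) by [].
exists N, (lin_of lv); split=> [|x]; first exact: val_inj.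
by split=> [Px|[y <-]]; [exists (mk Px) | exact: valP'].
Qed.

(** [choose] picks an element of the coset of [x] that depends on the coset only, so the quotient
    can be realised as the subtype of fixed points of [rep]. *)
Let rep x := choose (fun y => `[<P (x - y)>]) x.
Let repP x : P (x - rep x).
Proof.
apply/asboolP/(@chooseP _ (fun y => `[<P (x - y)>])).
by apply/asboolP; rewrite subrr; apply: submod0.
Qed.
Let rep_eq x y : P (x - y) -> rep x = rep y.
Proof.
move=> Pxy; rewrite /rep.
have e z : `[<P (x - z)>] = `[<P (y - z)>].
  apply: asbool_equiv_eq; split=> Pz.
    have -> : y - z = - (x - y) + (x - z) by rewrite opprB subrKA.
    by apply: submodD => //; apply: submodN.
  have -> : x - z = (x - y) + (y - z) by rewrite subrKA.
  exact: submodD.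
rewrite (eq_choose e); apply: choose_id; apply/asboolP; last first.
  by rewrite subrr; apply: submod0.
by rewrite -opprB; apply: submodN.
Qed.

Definition quom of submod P := {x : M | rep x == x}.
Local Notation Q := (quom subP).
HB.instance Definition _ := SubType.on Q.
HB.instance Definition _ := Choice.on Q.

Let repK x : rep (rep x) == rep x.
Proof. by apply/eqP/esym/rep_eq/repP. Qed.
Let pr x : Q := exist _ (rep x) (repK x).
Let pr_eq x y : P (x - y) -> pr x = pr y.
Proof. by move=> Pxy; apply: val_inj; apply: rep_eq. Qed.
Let pr_val (x : Q) : pr (val x) = x.
Proof. by apply: val_inj => /=; apply/eqP; case: x. Qed.
Let prP x : P (val (pr x) - x).
Proof. by rewrite -opprB; apply: submodN; apply: repP. Qed.
Let qadd (x y : Q) := pr (val x + val y).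
Let qopp (x : Q) := pr (- val x).
Let qscale a (x : Q) := pr (a *: val x).
Let qaddE x y : qadd (pr x) (pr y) = pr (x + y).
Proof. by apply: pr_eq; rewrite opprD addrACA; apply: submodD; apply: prP. Qed.
Let qscaleE a x : qscale a (pr x) = pr (a *: x).
Proof. by apply: pr_eq; rewrite -scalerBr; apply: submodZ; apply: prP. Qed.
Let qoppE x : qopp (pr x) = pr (- x).
Proof. by apply: pr_eq; rewrite -opprD; apply: submodN; apply: prP. Qed.
Let qaddA : associative qadd.
Proof.
by move=> x y z; rewrite -(pr_val x) -(pr_val y) -(pr_val z) !qaddE addrA.
Qed.
Let qaddC : commutative qadd.
Proof. by move=> x y; rewrite /qadd addrC. Qed.
Let qadd0 : left_id (pr 0) qadd.
Proof. by move=> x; rewrite -(pr_val x) qaddE add0r. Qed.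
Let qaddN : left_inverse (pr 0) qopp qadd.
Proof. by move=> x; rewrite -(pr_val x) qoppE qaddE addNr. Qed.
HB.instance Definition _ := GRing.isZmodule.Build Q qaddA qaddC qadd0 qaddN.
Let qscaleA a b (x : Q) : qscale a (qscale b x) = qscale (a * b) x.
Proof. by rewrite -(pr_val x) !qscaleE scalerA. Qed.
Let qscale1 : left_id 1 qscale.
Proof. by move=> x; rewrite -(pr_val x) qscaleE scale1r. Qed.
Let qscaleDr : right_distributive qscale +%R.
Proof.
move=> a x y; rewrite -(pr_val x) -(pr_val y) [_ + _]qaddE !qscaleE.
by rewrite [_ + _ in RHS]qaddE scalerDr.
Qed.
Let qscaleDl (v : Q) : {morph qscale^~ v : a b / a + b}.
Proof.
by move=> a b; rewrite -(pr_val v) !qscaleE [_ + _ in RHS]qaddE scalerDl.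
Qed.
HB.instance Definition _ :=
  GRing.Zmodule_isLmodule.Build S Q qscaleA qscale1 qscaleDr qscaleDl.

Lemma quotient_ex : exists (Q : lmodType S) (p : {linear M -> Q}),
  surj p /\ forall x, P x <-> p x = 0.
Proof.
have lp : linear (pr : M -> Q).
  by move=> a x y; rewrite -[_ + _ in RHS]/(qadd _ _) -[_ *: _ in RHS]/(qscale
    _ _)
    qscaleE qaddE.
exists Q, (lin_of lp); split=> [y|x]; first by exists (val y); apply: pr_val.
split=> [Px|prx]; first by apply: pr_eq; rewrite subr0.
rewrite -[x](subrK (rep x)); apply: submodD; first exact: repP.
have -> : rep x = rep 0 by apply: (congr1 val prx).
by rewrite -[rep 0](subKr 0) sub0r; apply: submodN; apply: repP.
Qed.
End Submodules.

(** * Length of modules *)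

Definition im_sub (S : pzRingType) (M N : lmodType S) (f : {linear M -> N})
  (P : M -> Prop) : N -> Prop := fun y => exists2 x, P x & f x = y.

Definition ker_sub (S : pzRingType) (M N : lmodType S) (f : {linear M -> N})
  (P : M -> Prop) : M -> Prop := fun x => P x /\ f x = 0.

Lemma submod_im (S : pzRingType) (M N : lmodType S) (f : {linear M -> N})
  (P : M -> Prop) : submod P -> submod (im_sub f P).
Proof.
move=> sP; split; first by exists 0; rewrite ?linear0 //; apply: submod0.
move=> a _ _ [x Px <-] [y Py <-]; exists (a *: x + y); last by rewrite linearP.
by case: sP => _; apply.
Qed.

Lemma submod_ker (S : pzRingType) (M N : lmodType S) (f : {linear M -> N})
  (P : M -> Prop) : submod P -> submod (ker_sub f P).
Proof.
move=> sP; split; first by split; [apply: submod0 | rewrite linear0].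
move=> a x y [Px fx] [Py fy]; split; first by case: sP => _; apply.
by rewrite linearP fx fy scaler0 addr0.
Qed.

Section Height.
Variables (S : pzRingType).
Implicit Types (M N : lmodType S).

(** Length is the supremum of such chains, so its additivity comes without composition series or the
    Jordan-Hoelder theorem. *)
Fixpoint has_chain M n (P : M -> Prop) : Prop :=
  if n is m.+1 then exists Q : M -> Prop,
    [/\ submod Q, (forall x, Q x -> P x), (exists2 x, P x & ~ Q x) &
      has_chain m Q]
  else True.

Definition finlen M (P : M -> Prop) := exists m, forall n, has_chain n P ->
  (n <= m)%N.

Lemma has_chain_mono M n (P P' : M -> Prop) :
  (forall x, P x -> P' x) -> has_chain n P -> has_chain n P'.
Proof.
case: n => // n sPP' [Q [sQ QP [x Px nQx] hQ]]; exists Q; split=> //.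
  by move=> y /QP /sPP'.
by exists x; first exact: sPP'.
Qed.

Lemma has_chain_le M m n (P : M -> Prop) : (m <= n)%N -> has_chain n P ->
  has_chain m P.
Proof.
elim: n m P => [|n IHn] [|m] // P lemn [Q [sQ QP ex hQ]].
by exists Q; split=> //; apply: IHn.
Qed.

Lemma finlen_sub M (P P' : M -> Prop) :
  (forall x, P x -> P' x) -> finlen P' -> finlen P.
Proof. by move=> sPP' [m hm]; exists m => n /(has_chain_mono sPP')/hm. Qed.

(** A strict step [Q < P] stays strict on the kernel or on the image: if both agree, then for [x] in
    [P] some [z] in [Q] has [f z = f x], and [x - z] lies in the common kernel. It may stay strict
    on both sides, hence the inequality. *)
Lemma has_chain_split M N (f : {linear M -> N}) n (P : M -> Prop) :
  submod P -> has_chain n P ->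
  exists a b, [/\ (n <= a + b)%N, has_chain a (ker_sub f P) &
    has_chain b (im_sub f P)].
Proof.
elim: n P => [|n IHn] P sP; first by exists 0, 0.
move=> [Q [sQ QP [x Px nQx] hQ]].
have [a [b [leab ha hb]]] := IHn Q sQ hQ.
have kQP y : ker_sub f Q y -> ker_sub f P y by case=> /QP.
have iQP y : im_sub f Q y -> im_sub f P y by case=> z /QP; exists z.
have [[y [Py fy] nQy]|sk] := pselect (exists2 y, ker_sub f P y & ~ Q y).
  exists a.+1, b; split=> //; last exact: has_chain_mono hb.
  exists (ker_sub f Q); split=> //; first exact: submod_ker.
  by exists y => // -[].
exists a, b.+1; split; rewrite ?addnS //; first exact: has_chain_mono ha.
exists (im_sub f Q); split=> //; first exact: submod_im.
exists (f x); first by exists x.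
case=> z Qz fzx; case: nQx; rewrite -(subrK z x).
apply: (submodD sQ) => //; apply: contrapT => nQ; case: sk.
exists (x - z) => //; split; last by rewrite linearB fzx subrr.
by apply: submodB => //; apply: QP.
Qed.

(** The chain in the image is pulled back along [f] and continued below by the chain in the kernel.
    The induction runs over arbitrary submodules [R] of the image. *)
Lemma has_chain_glue M N (f : {linear M -> N}) a b (P : M -> Prop) :
  submod P -> has_chain a (ker_sub f P) -> has_chain b (im_sub f P) ->
    has_chain (a + b) P.
Proof.
move=> sP ha hb; pose R := im_sub f P.
suff: has_chain (a + b) (fun x => P x /\ R (f x)) by apply: has_chain_mono =>
  x [].
have RP y : R y -> im_sub f P y by [].
have sR : submod R by apply: submod_im.
move: R (hb : has_chain b R) sR RP => {hb}.
elim: b => [|b IHb] R.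
  move=> _ sR RP; rewrite addn0; apply: has_chain_mono ha => x [Px fx];
    split=> //.
  by rewrite fx; apply: submod0.
move=> [R' [sR' R'R [y Ry nR'y] hR']] sR RP; rewrite addnS.
exists (fun x => P x /\ R' (f x)); split.
- split; first by split; [apply: submod0 | rewrite linear0; apply: submod0].
  move=> c x z [Px Rx] [Pz Rz]; split; first by case: sP => _; apply.
  by rewrite linearP; case: sR' => _; apply.
- by move=> x [Px /R'R].
- by have [x Px fx] := RP _ Ry; exists x; rewrite ?fx // => -[].
- by apply: IHb => // z /R'R/RP.
Qed.

Lemma finlen_glue M N (f : {linear M -> N}) (P : M -> Prop) : submod P ->
  finlen (ker_sub f P) -> finlen (im_sub f P) -> finlen P.
Proof.
move=> sP [a ha] [b hb]; exists (a + b)%N => n /(has_chain_split f sP).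
by case=> c [d [le_n /ha lec /hb led]]; apply: leq_trans le_n (leq_add _ _).
Qed.

Lemma finlen_im M N (f : {linear M -> N}) (P : M -> Prop) : submod P ->
  finlen P -> finlen (im_sub f P).
Proof.
by move=> sP [m hm]; exists m => n hn; apply/hm;
  apply: (@has_chain_glue _ _ f 0%N).
Qed.

Definition has_len M (P : M -> Prop) n := has_chain n P /\ ~ has_chain n.+1 P.

(** The value 0 is a default when the chains are unbounded; results that need the true length assume
    [finlen]. *)
Definition len M (P : M -> Prop) : nat :=
  if pselect (exists n, has_len P n) is left h then sval (cid h) else 0.

Lemma lenP M (P : M -> Prop) : finlen P -> has_len P (len P).
Proof.
move=> [m hm]; rewrite /len; case: pselect => [h|[]]; first by case: (cid h).
have ex : exists n, `[<has_chain n P>] by exists 0; apply/asboolP.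
have ub n : `[<has_chain n P>] -> (n <= m)%N by move/asboolP/hm.
case: (ex_maxnP ex ub) => n /asboolP hn max_n; exists n; split=> //.
by move/asboolP/max_n; rewrite ltnn.
Qed.

Lemma has_chain_len M (P : M -> Prop) n : finlen P ->
  has_chain n P <-> (n <= len P)%N.
Proof.
move=> /lenP[hl nhl]; split=> [hn|/has_chain_le]; last exact.
by rewrite leqNgt; apply/negP => lt; apply: nhl; apply: has_chain_le hn.
Qed.

Lemma len_add M N (f : {linear M -> N}) (P : M -> Prop) : submod P ->
  finlen P -> len P = (len (ker_sub f P) + len (im_sub f P))%N.
Proof.
move=> sP fP; have fI := finlen_im f sP fP.
have fK : finlen (ker_sub f P) by apply: (finlen_sub _ fP) => x [].
apply/eqP; rewrite eqn_leq; apply/andP; split.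
  have /(has_chain_split f sP)[a [b [le ha hb]]] :
    has_chain (len P) P by apply/has_chain_len.
  by apply: (leq_trans le); apply: leq_add; apply/has_chain_len.
by apply/(has_chain_len _ fP)/(has_chain_glue (f := f) sP); [case: (lenP fK) |
  case: (lenP fI)].
Qed.

Lemma len_le M (P Q : M -> Prop) : finlen P -> (forall x, Q x -> P x) ->
  (len Q <= len P)%N.
Proof.
move=> fP QP; apply/(has_chain_len _ fP)/(has_chain_mono QP).
by case: (lenP (finlen_sub QP fP)).
Qed.

Lemma len_eq M (P Q : M -> Prop) : finlen P -> submod Q ->
  (forall x, Q x -> P x) -> (len P <= len Q)%N -> forall x, P x -> Q x.
Proof.
move=> fP sQ QP le x Px; apply: contrapT => nQx.
have [hQ _] := lenP (finlen_sub QP fP).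
have : has_chain (len Q).+1 P by exists Q; split=> //; exists x.
by move/(has_chain_len _ fP) => lt; have := leq_ltn_trans le lt; rewrite ltnn.
Qed.

Lemma finlen0 M (P : M -> Prop) : (forall x, P x -> x = 0) -> finlen P.
Proof.
move=> P0; exists 0 => -[|n] // [Q [sQ QP [x Px nQx] _]]; case: nQx.
by rewrite (P0 x Px); apply: submod0.
Qed.

Lemma len0 M (P : M -> Prop) : (forall x, P x -> x = 0) -> len P = 0%N.
Proof.
move=> P0; apply/eqP; rewrite -leqn0 leqNgt; apply/negP.
case/(has_chain_len _ (finlen0 P0)) => Q [sQ QP [x Px nQx] _]; case: nQx.
by rewrite (P0 x Px); apply: submod0.
Qed.

Lemma len_inj M N (f : {linear M -> N}) (P : M -> Prop) : submod P ->
  finlen P -> (forall x, P x -> f x = 0 -> x = 0) -> len (im_sub f P) = len P.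
Proof. by move=> sP fP f0; rewrite (len_add f sP fP) [len (ker_sub f P)]len0
  ?add0n // => x []; apply: f0. Qed.

Definition span M n (g : 'I_n -> M) : M -> Prop :=
  fun x => exists c : 'I_n -> S, x = \sum_i c i *: g i.

Lemma submod_span M n (g : 'I_n -> M) : submod (span g).
Proof.
split; first by exists (fun=> 0); rewrite big1 // => i _; rewrite scale0r.
move=> a _ _ [c ->] [d ->]; exists (fun i => a * c i + d i).
by rewrite scaler_sumr -big_split; apply: eq_bigr => i _;
  rewrite scalerDl scalerA.
Qed.

Lemma mem_span M n (g : 'I_n -> M) i : span g (g i).
Proof.
exists (fun j => (j == i)%:R); rewrite (bigD1 i) //= eqxx scale1r big1 ?addr0
  //.
by move=> j /negPf->; rewrite scale0r.
Qed.

Lemma span_sub M n (g : 'I_n -> M) (P : M -> Prop) :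
  submod P -> (forall i, P (g i)) -> forall x, span g x -> P x.
Proof. by move=> sP Pg _ [c ->]; apply: submod_sum => // i; apply: submodZ. Qed.

(** Among the spans of finite families in [P] take one with the longest chain; a further element of
    [P] could be adjoined and would lengthen it. *)
Lemma finlen_fin_gen M (P : M -> Prop) : submod P -> finlen P ->
  exists n (g : 'I_n -> M), forall x, P x <-> span g x.
Proof.
move=> sP fP; pose T k := exists n (g : 'I_n -> M),
  (forall i, P (g i)) /\ has_chain k (span g).
have exT : exists k, `[<T k>] by exists 0; apply/asboolP; exists 0, (fun=> 0);
  split=> // -[].
have ubT k : `[<T k>] -> (k <= len P)%N.
  move/asboolP=> [n [g [Pg hg]]]; apply/has_chain_len => //.
  by apply: has_chain_mono hg; apply: span_sub.
case: (ex_maxnP exT ubT) => k /asboolP[n [g [Pg hg]]] maxk; exists n, g => x.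
split; last exact: span_sub.
move=> Px; apply: contrapT => ngx.
suff : `[<T k.+1>] by move/maxk; rewrite ltnn.
pose g' (i : 'I_n.+1) := if unlift ord0 i is Some j then g j else x.
have g'0 : g' ord0 = x by rewrite /g' unlift_none.
have g'S j : g' (lift ord0 j) = g j by rewrite /g' liftK.
apply/asboolP; exists n.+1, g'; split.
  by move=> i; rewrite /g'; case: unliftP.
exists (span g); split=> //; first exact: submod_span.
  apply: span_sub; first exact: submod_span.
  by move=> i; rewrite -g'S; apply: mem_span.
by exists x => //; rewrite -g'0; apply: mem_span.
Qed.

End Height.

(** * Artinian commutative rings have finite length *)

Lemma submod_ideal (R : comPzRingType) (P : R^o -> Prop) :
  submod P -> is_ideal P.
Proof.
move=> sP; split; [exact: submod0|exact: submodD|].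
by move=> a x; apply: (submodZ sP).
Qed.

(** If every member had a strictly smaller one, iterating a choice of it from [I0] would give a
    descending chain that never stabilises. *)
Lemma artinian_min (R : comPzRingType) (C : (R^o -> Prop) -> Prop)
    (I0 : R^o -> Prop) :
  artinian R -> submod I0 -> C I0 ->
  exists I : R^o -> Prop, [/\ submod I, C I & forall J : R^o -> Prop,
    submod J -> C J -> (forall x, J x -> I x) -> forall x, I x -> J x].
Proof.
move=> artR sI0 CI0; apply: contrapT => nmin.
pose T := {I : R^o -> Prop | submod I /\ C I}.
have /choice[f fP] : forall I : T, exists J : T,
    (forall x, sval J x -> sval I x) /\ exists2 x, sval I x & ~ sval J x.
  move=> [I [sI CI]] /=; apply: contrapT => nJ; apply: nmin; exists I.
  split=> // J sJ CJ JI x Ix; apply: contrapT => nJx; apply: nJ.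
  by exists (exist _ J (conj sJ CJ)); split=> //; exists x.
pose F n := iter n f (exist _ I0 (conj sI0 CI0)).
have [N hN] := artR (fun n => sval (F n))
  (fun n => submod_ideal (proj1 (svalP (F n)))) (fun n => proj1 (fP (F n))).
by have [_ [x Fx []]] := fP (F N); apply/(hN N.+1).
Qed.

Lemma submod_adjoin (S : pzRingType) (M : lmodType S) (P : M -> Prop) (x : M) :
  submod P -> submod (fun y => exists2 a, P (y - a *: x) & True).
Proof.
move=> sP; split; first by exists 0; rewrite ?scale0r ?subr0 //; apply: submod0.
move=> c y z [a Py _] [b Pz _]; exists (c * a + b) => //.
rewrite scalerDl opprD addrACA -scalerA -scalerBr.
by case: sP => _; apply.
Qed.

(* If R does not have finite length, take an ideal I minimal among those of
   infinite length: multiplication by any a is zero or onto on I, so that I is a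
   vector space over the field R/ann(I), and a hyperplane of I has finite
   length. *)
Lemma artinian_finlen (R : comPzRingType) :
  artinian R -> finlen (fun _ : R^o => True).
Proof.
move=> artR; apply: contrapT => nfR.
have sT : submod (fun _ : R^o => True) by [].
have [I [sI nfI minI]] :=
  artinian_min (C := fun P : R^o -> Prop => ~ finlen P) artR sT nfR.
have finI (J : R^o -> Prop) : submod J -> (forall x, J x -> I x) ->
    (exists2 x, I x & ~ J x) -> finlen J.
  move=> sJ JI [x Ix nJx]; apply: contrapT => nfJ.
  by apply: nJx; apply: minI Ix.
have lml (a : R) : linear (fun x : R^o => a * x : R^o).
  by move=> c x y; rewrite mulrDr mulrCA.
pose ml a := lin_of (lml a).
(* A proper kernel and a proper image would both have finite length by minimality of [I], and then
   so would [I]. *)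
have surjI a : (exists2 z, I z & a * z <> 0) -> forall x, I x ->
    exists2 y, I y & a * y = x.
  move=> [z Iz az] x Ix; apply: contrapT => nx; apply: nfI.
  apply: (finlen_glue (f := ml a)) => //.
    apply: finI; first exact: submod_ker.
      by move=> y [].
    by exists z => // -[].
  apply: finI; first exact: submod_im.
    by move=> _ [y Iy <-]; apply: (submodZ sI).
  by exists x.
(* The powers of [a] stabilise, say [a ^+ N = a ^+ N.+1 * b]; since [I] is divisible by [a ^+ N],
   this [b] inverts [a] on [I]. *)
have invI a : (exists2 z, I z & a * z <> 0) -> exists b, forall x, I x ->
  b * (a * x) = x.
  move=> /surjI aI.
  have [] := artR (fun n x => exists r, x = a ^+ n * r).
  - move=> n; split; first by exists 0; rewrite mulr0.
      by move=> _ _ [r ->] [s ->]; exists (r + s); rewrite mulrDr.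
    by move=> c _ [r ->]; exists (c * r); rewrite mulrCA.
  - by move=> n _ [r ->]; exists (a * r); rewrite exprSr mulrA.
  move=> N /(_ N.+1 (leqnSn N) (a ^+ N))[_ []]; first by exists 1;
    rewrite mulr1.
  move=> b eab; exists b => x Ix.
  have [y Iy <-] : exists2 y, I y & a ^+ N * y = x.
    elim: N {eab} => [|N IHN]; first by exists x; rewrite ?mul1r.
    have [y Iy <-] := IHN; have [z Iz <-] := aI _ Iy.
    by exists z => //; rewrite exprSr mulrA.
  by rewrite 2!mulrA -(mulrA b) -exprS (mulrC b) -eab.
have [x Ix x0] : exists2 x, I x & x <> 0.
  apply: contrapT => nx; apply: nfI; apply: finlen0 => x Ix.
  by apply: contrapT => x0; apply: nx; exists x.
(* The union of the empty chain is empty and not a submodule; [J0] puts 0 back so that Zorn's lemma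
   covers this case. *)
pose J0 (J : R^o -> Prop) := fun y => J y \/ y = 0.
pose C (J : R^o -> Prop) := [/\ submod (J0 J), (forall y, J y -> I y) & ~ J x].
have [] := @classical_sets.Zorn_bigcup R^o C.
  move=> F FC totF; split.
  - split; first by right.
    move=> a y z.
    have cl A u v : F A -> J0 A u -> J0 A v ->
        J0 (classical_sets.bigcup F (fun X => X)) (a *: u + v).
      move=> FA Ay Az; have [[_ /(_ a u v Ay Az)h] _ _] := FC _ FA.
      by case: h => [h|->]; [left; exists A | right].
    case=> [[A FA Ay]|->] [[B FB Bz]|->].
    + have [AB|BA] := totF _ _ FA FB.
        by apply: (cl B) => //; left => //; apply: AB.
      by apply: (cl A) => //; left => //; apply: BA.
    + by apply: (cl A) => //; [left|right].
    + by rewrite scaler0 add0r; left; exists B.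
    + by rewrite scaler0 add0r; right.
  - by move=> y [A /FC[_ AI _] Ay]; apply: AI.
  - by move=> [A /FC[_ _ nA] Ax].
move=> J [[sJ JI nJx] maxJ]; apply: nfI.
have J0I y : J0 J y -> I y by case=> [/JI|->] //; apply: submod0.
have [Q [p [_ pP]]] := quotient_ex sJ.
(* [J] is maximal among the submodules of [I] avoiding [x], so [I = J + R x]: for [y] outside [J]
   the element [x] lies in [J + R y], and the coefficient of [y] can be inverted. *)
have adj y : I y -> exists2 a, J0 J (y - a *: x) & True.
  move=> Iy; have [Jy|nJy] := pselect (J0 J y).
    by exists 0 => //; rewrite scale0r subr0.
  pose K := fun z => exists2 a, J0 J (z - a *: y) & True.
  have sK : submod K by apply: submod_adjoin.
  have JK z : J z -> K z by move=> Jz; exists 0 => //; rewrite scale0r subr0;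
    left.
  have Ky : K y by exists 1 => //; rewrite scale1r subrr; right.
  have [a Jxy _] : K x.
    apply: contrapT => nKx; apply: (maxJ K).
      by split=> [z /JK//|KJ]; apply: nJy; left; apply: KJ.
    split=> //.
      split; first by right.
      move=> a u v Ku Kv; left.
      have J0K w : J0 K w -> K w by case=> // ->; apply: submod0.
      by case: sK => _; apply; apply: J0K.
    move=> z [a /J0I Iz _]; rewrite -(subrK (a *: y) z).
    by apply: submodD => //; apply: submodZ.
  have [//|b bP] := invI a.
    exists y => // ay; move: Jxy; rewrite /GRing.scale /= ay subr0.
    by case.
  exists b => //; have := submodZ sJ (- b) Jxy.
  by rewrite scalerBr !scaleNr opprK [_ *: (_ *: _)]bP // addrC.
apply: (finlen_glue (f := p)) => //.
  apply: (finI _ (submod_ker p sI)); first by move=> y [].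
  by exists x => // -[_ /pP[]].
(* The image of [I] is the line through [p x]: a submodule [A] with some [B] strictly below it
   contains a nonzero multiple of [p x], hence [p x], hence everything. *)
exists 1 => -[|[|n]] // [A [sA AI [_ [y Iy <-] nAy] [B [sB BA [z Az nBz] _]]]].
exfalso; have [w Iw ez] := AI _ Az; have [a Ja _] := adj _ Iw.
have ez' : z = a *: p x.
  by apply/eqP; rewrite -ez -linearZ -subr_eq0 -linearB; apply/eqP/pP.
have [//|b bP] := invI a.
  exists x => // ax; apply: nBz; rewrite ez' -linearZ [_ *: _]ax linear0.
  exact: submod0.
have Ax : A (p x).
  have <- : b *: (a *: p x) = p x.
    by rewrite -(linearZZ p a) -(linearZZ p b); congr (p _); apply: bP.
  by rewrite -ez'; apply: submodZ.
have [c Jc _] := adj _ Iy; apply: nAy.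
have -> : p y = c *: p x.
  by apply/eqP; rewrite -linearZZ -subr_eq0 -linearB; apply/eqP/pP.
exact: submodZ.
Qed.

(** * Lengths over the base ring and Hom groups *)

(** By induction on the number of generators: modulo the span of the others, one generator gives an
    image of [R] itself. *)
Lemma finlen_span (R : comPzRingType) (V : lmodType R) n (g : 'I_n -> V) :
  artinian R -> finlen (span g).
Proof.
move=> artR; elim: n g => [|n IHn] g.
  by apply: finlen0 => x [c ->]; rewrite big_ord0.
pose g' i := g (lift ord0 i).
have [Q [p [_ pP]]] := quotient_ex (submod_span g').
have lq : linear (fun r : R^o => r *: p (g ord0)).
  by move=> a x y; rewrite scalerDl scalerA.
apply: (finlen_glue (f := p)); first exact: submod_span.
  by apply: finlen_sub (IHn g') => x [_ /pP].
have /(finlen_im (lin_of lq)) : submod (fun _ : R^o => True) by [].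
move/(_ (artinian_finlen artR)); apply: finlen_sub => _ [_ [c ->] <-].
exists (c ord0) => //=; rewrite big_ord_recl linearD linearZZ.
rewrite [X in _ + X](_ : _ = 0) ?addr0 //.
by apply/pP; exists (fun i => c (lift ord0 i)).
Qed.

Lemma fin_gen_quot (S : pzRingType) (M Q : lmodType S) (p : {linear M -> Q}) :
  fin_gen M -> surj p -> fin_gen Q.
Proof.
move=> [n [g gP]] sp; exists n, (p \o g) => y.
have [x <-] := sp y; have [c ->] := gP x; exists c.
by rewrite linear_sum; apply: eq_bigr => i _; rewrite linearZZ.
Qed.

Section Restriction.
Variables (R : comPzRingType) (L : pzRingType) (phi : {rmorphism R -> L}).

Section ResModule.
Variable Y : rmodType L.
(** Restriction of scalars along [phi]. The morphism is an argument of the type, so that the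
    [R]-module structure can be attached to it. *)
Definition res of {rmorphism R -> L} : Type := Y.
Local Notation resY := (res phi).
HB.instance Definition _ := GRing.Zmodule.copy resY Y.
Let scale (r : R) (y : resY) : resY := (phi r : L^c) *: (y : Y).
Let scaleA a b v : scale a (scale b v) = scale (a * b) v.
Proof. by rewrite /scale scalerA mulrC rmorphM. Qed.
Let scale1 : left_id 1 scale.
Proof. by move=> v; rewrite /scale rmorph1 scale1r. Qed.
Let scaleDr : right_distributive scale +%R.
Proof. by move=> a u v; apply: scalerDr. Qed.
Let scaleDl v : {morph scale^~ v : a b / a + b}.
Proof. by move=> a b; rewrite /scale rmorphD; apply: scalerDl. Qed.
HB.instance Definition _ :=
  GRing.Zmodule_isLmodule.Build R resY scaleA scale1 scaleDr scaleDl.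
End ResModule.

Lemma res_scaleE (Y : rmodType L) r (y : Y) :
  r *: (y : res Y phi) = (phi r : L^c) *: y.
Proof. by []. Qed.

Lemma submod_res (Y : rmodType L) (P : Y -> Prop) :
  submod P -> submod (P : res Y phi -> Prop).
Proof. by move=> [P0 PL]; split=> // a x y; apply: PL. Qed.

Lemma linear_res (X Y : rmodType L) (f : {linear X -> Y}) :
  linear (f : res X phi -> res Y phi).
Proof. by move=> a x y; apply: (linearP f). Qed.

Hypothesis artinL : artin_algebra phi.

Lemma phi_central a x : phi a * x = x * phi a. Proof. by case: artinL. Qed.

(** Over [R] the module is spanned by the products of generators of [L] with generators of [Y];
    centrality of [phi] lets the coefficients move past the reversed product of [L^c]. *)
Lemma finlen_res (Y : fgmod L) : finlen (fun _ : res Y phi => True).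
Proof.
have [artR _ [m [h hP]]] := artinL.
case: Y => Y [n [g gP]] /=.
pose G (k : 'I_#|{: 'I_n * 'I_m}|) : res Y phi :=
  let: (i, j) := enum_val k in (h j : L^c) *: g i.
apply: finlen_sub (finlen_span G artR) => y _.
have sG := submod_span G.
have [c ->] := gP y; apply: (submod_sum sG) => i.
have [d ->] := hP (c i).
have -> : ((\sum_j phi (d j) * h j) : L^c) *: g i =
    \sum_j (d j) *: (((h j : L^c) *: g i) : res Y phi).
  rewrite scaler_suml; apply: eq_bigr => j _; rewrite res_scaleE scalerA.
  by congr (_ *: _); apply: (phi_central (d j) (h j)).
apply: (submod_sum sG) => j; apply: (submodZ sG).
by have := mem_span G (enum_rank (i, j)); rewrite /G enum_rankK.
Qed.

Lemma finlenP (Y : fgmod L) (P : res Y phi -> Prop) : finlen P.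
Proof. exact: finlen_sub (finlen_res Y). Qed.

(** A submodule has finite length over [R], hence is finitely generated already over [R]. This keeps
    kernels and images inside [fgmod L]. *)
Lemma submodule_fg (Y : fgmod L) (P : Y -> Prop) : submod P ->
  exists (N : fgmod L) (i : {linear N -> Y}),
    injective i /\ forall x, P x <-> exists y, i y = x.
Proof.
move=> sP; have [N [i [inj_i iP]]] := submodule_ex sP.
have [n [g gP]] := finlen_fin_gen (submod_res sP) (@finlenP Y P).
have /choice[h hP] : forall k, exists y, i y = g k.
  by move=> k; apply/iP/(gP (g k))/mem_span.
have fgN : fin_gen N.
  exists n, h => x; have /gP[c cE] : P (i x) by apply/iP; exists x.
  exists (fun k => phi (c k)); apply: inj_i; rewrite linear_sum cE.
  by apply: eq_bigr => k _; rewrite linearZZ hP.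
by exists (FGMod fgN), i.
Qed.

Lemma quotient_fg (Y : fgmod L) (P : Y -> Prop) : submod P ->
  exists (Q : fgmod L) (p : {linear Y -> Q}),
    surj p /\ forall x, P x <-> p x = 0.
Proof.
move=> sP; have [Q [p [sp pP]]] := quotient_ex sP.
by exists (FGMod (fin_gen_quot (fgmod_fin_gen Y) sp)), p.
Qed.

(* Hom(X, Y), as an R-submodule of the module of all functions. *)
Definition homs (X Y : rmodType L) : (X -> res Y phi) -> Prop :=
  fun f => linear (f : X -> Y).

Lemma submod_homs X Y : submod (@homs X Y).
Proof.
split.
  move=> a x y; have e : a *: (0 : Y) + 0 = 0 by rewrite scaler0 addr0.
  exact: esym e.
move=> r f g lf lg a x y; rewrite -[LHS]/(r *: f (a *: x + y) + g (a *: x + y)).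
rewrite -[RHS]/(a *: (r *: f x + g x) + (r *: f y + g y)) [f _]lf [g _]lg
  !scalerDr addrACA; congr (_ + _ + _).
by rewrite !res_scaleE !scalerA; congr (_ *: _); apply/esym/phi_central.
Qed.

(** Maps are filtered by the number of generators of [X] on which they vanish; evaluation at the
    next generator embeds each layer into [Y], and a map killing all generators is zero. *)
Lemma finlen_homs (X Y : fgmod L) : finlen (@homs X Y).
Proof.
have [n [g gP]] := fgmod_fin_gen X.
pose P k f := @homs X Y f /\ forall i : 'I_n, (i < k)%N -> f (g i) = 0.
have sP k : submod (P k).
  split; first by split=> //; apply: (submod0 (@submod_homs X Y)).
  move=> a f f' [lf f0] [lf' f'0]; split; first exact: (submod_homs X Y).2.
  move=> i ltik; rewrite -[LHS]/(a *: f (g i) + f' (g i)).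
  by rewrite f0 // f'0 // scaler0 addr0.
suff finP k : (k <= n)%N -> finlen (P (n - k)%N).
  by apply: finlen_sub (finP n (leqnn n)); rewrite subnn.
elim: k => [|k IHk] lekn.
  apply: finlen0 => f [lf f0]; apply/funext => x; have [c ->] := gP x.
  rewrite [LHS](linear_sum (lin_of lf)) big1 // => i _.
  by rewrite linearZZ /= f0 ?scaler0 // subn0.
have ltjn : (n - k.+1 < n)%N by rewrite ltn_subrL; case: (n) lekn.
pose j := Ordinal ltjn.
have lev : linear (fun f : X -> res Y phi => f (g j)) by [].
apply: (finlen_glue (f := lin_of lev)) => //; last exact: finlenP.
apply: finlen_sub (IHk (ltnW lekn)) => f [[lf f0] fj]; split=> // i.
rewrite -subSS subSn // ltnS leq_eqVlt => /orP[/eqP ei|]; last exact: f0.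
by rewrite -[RHS]fj /=; congr (f (g _)); apply: val_inj.
Qed.

Lemma hom_fin_gen (X Y : fgmod L) : exists n (h : 'I_n -> {linear X -> Y}),
  forall f : {linear X -> Y}, exists c : 'I_n -> R,
    forall x, f x = \sum_i (phi (c i) : L^c) *: h i x.
Proof.
have [n [g gP]] := finlen_fin_gen (submod_homs X Y) (finlen_homs X Y).
have lg i : linear (g i : X -> Y) by apply/(gP (g i))/mem_span.
exists n, (fun i => lin_of (lg i)) => f.
have /gP[c /(congr1 (fun F => F _))cE] : @homs X Y f by apply: linearP.
by exists c => x; rewrite cE fct_sumE.
Qed.

Definition homlen (X Y : fgmod L) := len (@homs X Y).

(** The condition on extending maps makes [0 -> Hom(X,Y) -> Hom(P,Y) -> Hom(K,Y) -> 0] exact. It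
    will come from [Ext1_eq0 X Y], so that Hom lengths can be read off projective presentations. *)
Lemma homlen_exact (K P X Y : fgmod L) (i : {linear K -> P})
    (p : {linear P -> X}) :
  exact_at i p -> surj p ->
  (forall h : {linear K -> Y}, exists k : {linear P -> Y}, forall x,
    k (i x) = h x) ->
  homlen P Y = (homlen X Y + homlen K Y)%N.
Proof.
move=> ex_ip sp ext; rewrite /homlen.
have lF : linear (fun f : P -> res Y phi => f \o i : K -> res Y phi) by [].
have lG : linear (fun f : X -> res Y phi => f \o p : P -> res Y phi) by [].
rewrite (len_add (lin_of lF) (submod_homs P Y) (finlen_homs P Y)).
rewrite -(len_inj (f := lin_of lG) (submod_homs X Y) (finlen_homs X Y));
  last first.
  move=> f _ /= f0; apply/funext => x; have [y <-] := sp x.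
  exact: (congr1 (fun F => F y) f0).
congr (_ + _)%N; congr len; apply/funext => f; apply/propext; split.
- case=> lf fi0.
  have [k kP] : exists k : {linear X -> Y}, forall x, k (p x) = f x.
    apply: (factor_surj (f := lin_of lf)) => // x /ex_ip[w <-].
    exact: (congr1 (fun F => F w) fi0).
  exists (k : X -> Y); first exact: linearP.
  by apply/funext => x /=; rewrite kP.
- case=> k lk <-; split; first by move=> a x y /=; rewrite linearP [k _]lk.
  apply/funext => x /=; have -> : p (i x) = 0 by apply/ex_ip; exists x.
  exact: (linear0 (lin_of lk)).
- by case=> k lk <- a x y /=; rewrite linearP [k _]lk.
- move=> lf; have [k kP] := ext (lin_of lf).
  by exists (k : P -> Y); [exact: linearP | apply/funext => x; apply: kP].
Qed.

End Restriction.

(** * Ext and pushouts *)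

Fact pinl_linear (S : pzRingType) (A B : lmodType S) :
  linear (fun x : A => (x, 0) : A * B).
Proof.
move=> a x y; have e : 0 = a *: (0 : B) + 0 by rewrite scaler0 addr0.
exact: (congr1 (fun u => (a *: x + y, u) : A * B) e).
Qed.

Fact pinr_linear (S : pzRingType) (A B : lmodType S) :
  linear (fun x : B => (0, x) : A * B).
Proof.
move=> a x y; have e : 0 = a *: (0 : A) + 0 by rewrite scaler0 addr0.
exact: (congr1 (fun u => (u, a *: x + y) : A * B) e).
Qed.

Definition pinl S (A B : lmodType S) : {linear A -> (A * B)%type} :=
  lin_of (@pinl_linear S A B).
Definition pinr S (A B : lmodType S) : {linear B -> (A * B)%type} :=
  lin_of (@pinr_linear S A B).

Section Ext.
Variable S : pzRingType.
Implicit Types (A B C E K M P T U X Y : lmodType S).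

Lemma inj_surj_bij (X Y : Type) (f : X -> Y) : injective f -> surj f ->
  bijective f.
Proof.
by move=> fI /choice[g fg]; exists g => // x; apply: fI; rewrite fg.
Qed.

Lemma inj_lin0 X Y (f : {linear X -> Y}) :
  (forall x, f x = 0 -> x = 0) -> injective f.
Proof.
move=> f0 x y fxy; apply/eqP; rewrite -subr_eq0; apply/eqP/f0.
by rewrite linearB fxy subrr.
Qed.

(** In one direction the extension is compared with the trivial one on [C * X]; in the other, two
    split extensions are identified by sending [i c + s x] to [i' c + s' x]. *)
Lemma Ext1_sectionP X C : Ext1_eq0 X C <->
  forall E (i : {linear C -> E}) (p : {linear E -> X}), short_exact i p ->
  exists s : {linear X -> E}, forall x, p (s x) = x.
Proof.
split=> [ext0 E i p ip|sec].
  have se : short_exact (pinl C X) (snd : {linear (C * X)%type -> X}).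
    split; first by move=> x y [].
      move=> [c x] /=; split=> [->|[y [_ <-]]//]; by exists c.
    by move=> x; exists (0, x).
  have [f [_ _ fP]] := ext0 (Extension se) (Extension ip).
  by exists (f \o pinr C X) => x /=; rewrite [LHS]fP.
move=> [E i p ip] [E' i' p' ip'].
have [s sP] := sec E i p ip; have [s' s'P] := sec E' i' p' ip'.
case: ip ip' => [inj_i ex_i sp] [inj_i' ex_i' sp'].
have le : linear (fun e => e - s (p e)).
  by move=> a x y; rewrite !linearP addrACA scalerDr.
have [r rP] : exists r : {linear E -> C}, forall e, i (r e) = e - s (p e).
  apply: (factor_inj (f := lin_of le)) => // e; apply/ex_i.
  by rewrite linearB sP subrr.
have lf : linear (fun e => i' (r e) + s' (p e)).
  by move=> a x y; rewrite !linearP scalerDr addrACA.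
exists (lin_of lf); split.
- apply: inj_surj_bij.
    apply: inj_lin0 => e /= fe0.
    have pe0 : p e = 0.
      have /(congr1 p') := fe0; rewrite linearD s'P linear0.
      by have -> : p' (i' (r e)) = 0; [apply/ex_i'; exists (r e) |
        rewrite add0r].
    move: fe0; rewrite pe0 !linear0 addr0 -(linear0 i') => /inj_i' re0.
    by have := rP e; rewrite re0 pe0 !linear0 addr0.
  move=> e'; have [x xe'] := sp (p' e').
  have /ex_i'[c cE] : p' (e' - s' (p' e')) = 0 by rewrite linearB s'P subrr.
  exists (i c + s (p x)) => /=.
  have pc : p (i c) = 0 by apply/ex_i; exists c.
  have -> : r (i c + s (p x)) = c.
    by apply: inj_i; rewrite rP linearD pc sP add0r addrK.
  by rewrite linearD pc sP add0r xe' cE subrK.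
- move=> c /=; have pc : p (i c) = 0 by apply/ex_i; exists c.
  rewrite pc linear0 addr0; congr (i' _); apply: inj_i.
  by rewrite rP pc linear0 subr0.
- move=> e /=; rewrite linearD s'P.
  by have -> : p' (i' (r e)) = 0; [apply/ex_i'; exists (r e) | rewrite add0r].
Qed.

(** The pullback of the extension along [u] splits; a section followed by the projection to [E] is
    the lift. *)
Lemma Ext1_lift U C E T (i : {linear C -> E}) (p : {linear E -> T})
    (u : {linear U -> T}) :
  Ext1_eq0 U C -> short_exact i p ->
  exists v : {linear U -> E}, forall x, p (v x) = u x.
Proof.
move=> /Ext1_sectionP ext0 [inj_i ex_i sp].
pose G (z : E * U) := p z.1 = u z.2.
have sG : submod G.
  split; first by rewrite /G !linear0.
  by move=> a [x x'] [y y']; rewrite /G /= => e e'; rewrite !linearP e e'.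
have [N [j [inj_j jP]]] := submodule_ex sG.
have [k kP] : exists k : {linear C -> N}, forall c, j (k c) = (i c, 0).
  apply: (factor_inj (f := pinl E U \o i)) => // c; apply/jP.
  by rewrite /G /= linear0; apply/ex_i; exists c.
have [|s sP] := ext0 N k (snd \o j).
  split.
  - by move=> x y /(congr1 j); rewrite !kP => -[/inj_i].
  - move=> y /=; split=> [yj|[c <-]]; last by rewrite kP.
    have : G (j y) by apply/jP; exists y.
    rewrite /G yj linear0 => /ex_i[c cE]; exists c; apply: inj_j.
    by rewrite kP cE -yj; case: (j y).
  - move=> x; have [e eE] := sp (u x).
    by have /jP[y yE] : G (e, x) by []; exists y; rewrite /= yE.
exists (fst \o (j \o s)) => x /=.
have : G (j (s x)) by apply/jP; exists (s x).
by rewrite /G => ->; congr (u _); apply: sP.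
Qed.

Lemma pushout_ex X C K P (i : {linear K -> P}) (p : {linear P -> X})
    (h : {linear K -> C}) : short_exact i p ->
  exists E (l : {linear C -> E}) (m : {linear P -> E}) (g : {linear E -> X}),
  [/\ short_exact l g, forall k, m (i k) = l (h k), forall x, g (m x) = p x,
      forall e, exists c x, e = l c + m x &
      forall (N : lmodType S) (a : {linear C -> N}) (b : {linear P -> N}),
        (forall k, b (i k) = a (h k)) ->
        exists t : {linear E -> N},
          (forall c, t (l c) = a c) /\ (forall x, t (m x) = b x)].
Proof.
move=> [inj_i ex_i sp].
pose G (z : C * P) := exists2 k, z.1 = - h k & z.2 = i k.
have sG : submod G.
  split; first by exists 0; rewrite linear0 ?oppr0.
  move=> a [x x'] [y y'] [k /= -> ->] [k' /= -> ->]; exists (a *: k + k') => /=.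
    by rewrite linearP opprD scalerN.
  by rewrite linearP.
have [E [q [sq qP]]] := quotient_ex sG.
have [l lE] : exists l : {linear C -> E}, forall c, l c = q (c, 0).
  by exists (q \o pinl C P).
have [m mE] : exists m : {linear P -> E}, forall x, m x = q (0, x).
  by exists (q \o pinr C P).
have qE c x : q (c, x) = l c + m x.
  rewrite lE mE -linearD; congr (q _); apply/pair_equal_spec.
  by split; [rewrite [RHS]addr0 | rewrite [RHS]add0r].
have mi k : m (i k) = l (h k).
  apply/eqP; rewrite -subr_eq0 lE mE -linearB; apply/eqP/qP; exists k => /=.
    by rewrite sub0r.
  by rewrite subr0.
have univ (N : lmodType S) (a : {linear C -> N}) (b : {linear P -> N}) :
    (forall k, b (i k) = a (h k)) -> exists t : {linear E -> N},
      (forall c, t (l c) = a c) /\ (forall x, t (m x) = b x).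
  move=> ab; have lf : linear (fun z : C * P => a z.1 + b z.2).
    by move=> c x y; rewrite !linearP scalerDr addrACA.
  have [z /qP[k /= -> ->]|t tP] := factor_surj (f := lin_of lf) sq.
    by rewrite ab linearN addNr.
  exists t; split=> [c|x]; first by rewrite lE tP /= linear0 addr0.
  by rewrite mE tP /= linear0 add0r.
have [k|g [gl gm]] := univ X \0 p; first by apply/ex_i; exists k.
have Elm e : exists c x, e = l c + m x.
  by have [[c x] <-] := sq e; exists c, x.
exists E, l, m, g; split=> //; split.
- apply: inj_lin0 => c; rewrite lE => /qP[k /= -> ik].
  by have -> : k = 0; [apply: inj_i; rewrite linear0 -ik |
    rewrite linear0 oppr0].
- move=> e; have [c [x ->]] := Elm e; rewrite linearD gl gm add0r.
  split=> [/ex_i[k <-]|[c' e']]; first by exists (c + h k); rewrite mi linearD.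
  by rewrite -gm -[m x](addKr (l c)) -e' linearD linearN !gl oppr0 addr0.
- by move=> x; have [y <-] := sp x; exists (m y).
Qed.

(** The pushout along [h] is an extension of [X] by [C], hence splits; [m] followed by the
    retraction onto [C] extends [h]. *)
Lemma Ext1_extend X C K P (i : {linear K -> P}) (p : {linear P -> X})
    (h : {linear K -> C}) :
  Ext1_eq0 X C -> short_exact i p ->
  exists h' : {linear P -> C}, forall k, h' (i k) = h k.
Proof.
move=> /Ext1_sectionP ext0 ip.
have [E [l [m [g [lg mi gm Elm _]]]]] := pushout_ex h ip.
have [s sP] := ext0 E l g lg.
case: ip lg => [inj_i ex_i sp] [inj_l ex_l sg].
have lf : linear (fun x => m x - s (p x)).
  by move=> a x y; rewrite !linearP addrACA scalerDr.
have [r rP] : exists r : {linear P -> C}, forall x, l (r x) = m x - s (p x).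
  apply: (factor_inj (f := lin_of lf)) => // x; apply/ex_l.
  by rewrite linearB sP gm subrr.
exists r => k; apply: inj_l; rewrite rP mi; have -> : p (i k) = 0.
  by apply/ex_i; exists k.
by rewrite linear0 subr0.
Qed.

(** Converse of [Ext1_extend] for projective [P]: a lift of [p] to the middle term of an extension
    restricts to a map [K -> C], and subtracting an extension of that map leaves one that kills [K]
    and descends to a section. *)
Lemma extend_Ext1 X C K P (i : {linear K -> P}) (p : {linear P -> X}) :
  projective P -> short_exact i p ->
  (forall h : {linear K -> C}, exists h' : {linear P -> C}, forall k,
    h' (i k) = h k) ->
  Ext1_eq0 X C.
Proof.
move=> projP [inj_i ex_i sp] ext; apply/Ext1_sectionP => E j q [inj_j ex_j sq].
have [f fP] := projP E X q p sq.
have [h hP] : exists h : {linear K -> C}, forall k, j (h k) = f (i k).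
  apply: (factor_inj (f := f \o i)) => // k; apply/ex_j; rewrite fP.
  by apply/ex_i; exists k.
have [h' h'P] := ext h.
have lf : linear (fun x => f x - j (h' x)).
  by move=> a x y; rewrite !linearP addrACA scalerDr.
have [s sP] : exists s : {linear X -> E}, forall x, s (p x) = f x - j (h' x).
  apply: (factor_surj (f := lin_of lf)) => // x /ex_i[k <-] /=.
  by rewrite h'P hP subrr.
exists s => x; have [y <-] := sp x; rewrite sP linearB fP.
have -> : q (j (h' y)) = 0 by apply/ex_j; exists (h' y).
exact: subr0.
Qed.

(** [hereditary] speaks of submodules of the regular module only; this property passes to submodules
    and finite products, and so reaches the finite free modules. *)
Definition hereditary_mod P := forall K (i : {linear K -> P}), injective i ->
  projective K.

Lemma hereditary_mod_projective P : hereditary_mod P -> projective P.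
Proof. by move=> /(_ P idfun); apply. Qed.

Lemma hereditary_mod_sub P P' (i : {linear P' -> P}) : injective i ->
  hereditary_mod P -> hereditary_mod P'.
Proof. by move=> inj_i hP K j inj_j; apply: (hP K (i \o j));
  apply: inj_comp. Qed.

Lemma projective_prod X A B (f : {linear X -> A}) (g : {linear X -> B})
   (f' : {linear A -> X}) (g' : {linear B -> X}) :
  (forall x, x = f' (f x) + g' (g x)) ->
  projective A -> projective B -> projective X.
Proof.
move=> e pA pB M N q h sq.
have [k kP] := pA M N q (h \o f') sq; have [l lP] := pB M N q (h \o g') sq.
have lm : linear (fun x => k (f x) + l (g x)).
  by move=> a x y; rewrite !linearP scalerDr addrACA.
by exists (lin_of lm) => x /=; rewrite linearD kP lP {3}[x]e linearD.
Qed.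

(** The image [I] of [K] in [B] is projective, so [K] is the sum of [I] and of the kernel [K'],
    which embeds into [A]. *)
Lemma hereditary_mod_prod A B : hereditary_mod A -> hereditary_mod B ->
  hereditary_mod (A * B)%type.
Proof.
move=> hA hB K i inj_i.
have sP : submod (im_sub (snd \o i) (fun _ : K => True)) by apply: submod_im.
have [I [j [inj_j jP]]] := submodule_ex sP.
have projI := hB I j inj_j.
have [q qP] : exists q : {linear K -> I}, forall x, j (q x) = (i x).2.
  apply: (factor_inj (f := snd \o i)) => // x; apply/jP.
  by exists x.
have sq : surj q.
  move=> y; have /jP[x _ xE] : exists y', j y' = j y by exists y.
  by exists x; apply: inj_j; rewrite qP.
have [s sP'] := projI K I q idfun sq.
have sK : submod (fun x => q x = 0).
  split=> [|a x y qx qy]; first exact: linear0.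
  by rewrite linearP qx qy scaler0 addr0.
have [K' [k [inj_k kP]]] := submodule_ex sK.
have projK' : projective K'.
  apply: (hA K' (fst \o (i \o k))); apply: inj_lin0 => x /= ix.
  apply: inj_k; apply: inj_i; rewrite !linear0.
  have qx : q (k x) = 0 by apply/kP; exists x.
  by have := qP (k x); rewrite qx linear0; case: (i (k x)) ix => ? ? /= -> <-.
have lf : linear (fun x => x - s (q x)).
  by move=> a x y; rewrite !linearP addrACA scalerDr.
have [r rP] : exists r : {linear K -> K'}, forall x, k (r x) = x - s (q x).
  apply: (factor_inj (f := lin_of lf)) => // x; apply/kP.
  by rewrite linearB sP' subrr.
apply: (@projective_prod K K' I r q k s _ projK' projI) => x.
by rewrite rP subrK.
Qed.

End Ext.

(** * Additive closures and Ext over hereditary algebras *)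

Section DirectProduct.
Variables (S : pzRingType) (n : nat) (X : 'I_n -> lmodType S).
Definition dprod_mod := forall i, X i.
Local Notation T := dprod_mod.
HB.instance Definition _ := gen_eqMixin T.
HB.instance Definition _ := gen_choiceMixin T.
Let add (f g : T) : T := fun i => f i + g i.
Let opp (f : T) : T := fun i => - f i.
Let zero : T := fun i => 0.
Let scale a (f : T) : T := fun i => a *: f i.
Let addA : associative add.
Proof.
by move=> f g h; apply: functional_extensionality_dep => i; apply: addrA.
Qed.
Let addC : commutative add.
Proof. by move=> f g; apply: functional_extensionality_dep => i;
  apply: addrC. Qed.
Let add0 : left_id zero add.
Proof. by move=> f; apply: functional_extensionality_dep => i;
  apply: add0r. Qed.
Let addN : left_inverse zero opp add.
Proof. by move=> f; apply: functional_extensionality_dep => i;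
  apply: addNr. Qed.
HB.instance Definition _ := GRing.isZmodule.Build T addA addC add0 addN.
Let scaleA a b (f : T) : scale a (scale b f) = scale (a * b) f.
Proof. by apply: functional_extensionality_dep => i; apply: scalerA. Qed.
Let scale1 : left_id 1 scale.
Proof. by move=> f; apply: functional_extensionality_dep => i;
  apply: scale1r. Qed.
Let scaleDr : right_distributive scale +%R.
Proof.
by move=> a f g; apply: functional_extensionality_dep => i; apply: scalerDr.
Qed.
Let scaleDl (f : T) : {morph scale^~ f : a b / a + b}.
Proof.
by move=> a b; apply: functional_extensionality_dep => i; apply: scalerDl.
Qed.
HB.instance Definition _ :=
  GRing.Zmodule_isLmodule.Build S T scaleA scale1 scaleDr scaleDl.

Let cast i j (e : i = j) (x : X i) : X j := eq_rect i (fun k => X k) x j e.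
Let inj i (x : X i) : T := fun j => if i =P j is ReflectT e then cast e x else
  0.
Let inj_lin i : linear (@inj i).
Proof.
move=> a x y; apply: functional_extensionality_dep => j.
rewrite -[RHS]/(a *: inj x j + inj y j) /inj; case: eqP => [e|_].
  by case: _ / e.
by rewrite scaler0 addr0.
Qed.
Let proj_lin i : linear (fun f : T => f i).
Proof. by []. Qed.

Lemma is_dirsum_dprod : is_dirsum X T.
Proof.
exists (fun i => lin_of (@inj_lin i)), (fun i => lin_of (@proj_lin i)).
have injE i (x : X i) : inj x i = x.
  by rewrite /inj; case: eqP => // e; rewrite (eq_axiomK e).
have inj0 i j (x : X i) : i != j -> inj x j = 0 by rewrite /inj; case: eqP.
split=> [i x|i j ij x|f]; [exact: injE | exact: inj0 |].
apply: functional_extensionality_dep => j.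
rewrite -[RHS]/(lin_of (@proj_lin j) _) linear_sum (bigD1 j) //= injE.
by rewrite big1 ?addr0 // => i ij; apply: inj0.
Qed.
End DirectProduct.

Section AddClosure.
Variable S : pzRingType.
Implicit Types (U M N : lmodType S).

(* Equivalently, f factors through an object of add U. *)
Definition factors_add U M N (f : M -> N) := exists (n : nat)
  (a : 'I_n -> {linear M -> U}) (b : 'I_n -> {linear U -> N}),
  forall m, f m = \sum_i b i (a i m).

Lemma eq_factors_add U M N (f g : M -> N) : f =1 g -> factors_add U f ->
  factors_add U g.
Proof. by move=> fg [n [a [b e]]]; exists n, a, b => m; rewrite -fg. Qed.

Lemma factors_add1 U M N (f : M -> N) (a : {linear M -> U}) (b : {linear U ->
  N}) :
  (forall m, f m = b (a m)) -> factors_add U f.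
Proof.
by move=> e; exists 1, (fun=> a), (fun=> b) => m; rewrite big_ord1.
Qed.

Lemma factors_addD U M N (f g : M -> N) : factors_add U f -> factors_add U g ->
  factors_add U (fun m => f m + g m).
Proof.
move=> [n [a [b e]]] [n' [a' [b' e']]].
exists (n + n')%N, (fun i => match fintype.split i with inl j => a j | inr j =>
  a' j end),
  (fun i => match fintype.split i with inl j => b j | inr j => b' j end) => m.
rewrite big_split_ord /= e e'; congr (_ + _); apply: eq_bigr => i _.
  by rewrite (unsplitK (inl i)).
by rewrite (unsplitK (inr i)).
Qed.

Lemma factors_add_sum U M N n (f : 'I_n -> M -> N) : (forall i,
  factors_add U (f i)) ->
  factors_add U (fun m => \sum_i f i m).
Proof.
elim: n f => [|n IHn] f fU.
  exists 0, (fun=> \0), (fun=> \0) => m; rewrite !big_ord0 //.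
apply: eq_factors_add (factors_addD (fU ord0) (IHn (fun i =>
  f (lift ord0 i)) _)) => //.
by move=> m; rewrite big_ord_recl.
Qed.

Lemma factors_add_comp U M M' N N' (f : M -> N) (g : {linear M' -> M})
    (h : {linear N -> N'}) :
  factors_add U f -> factors_add U (fun m => h (f (g m))).
Proof.
move=> [n [a [b e]]]; exists n, (fun i => a i \o g), (fun i => h \o b i) => m.
by rewrite e linear_sum.
Qed.

Lemma factors_add_trans V U M N (f : M -> N) :
  factors_add V (fun u : U => u) -> factors_add U f -> factors_add V f.
Proof.
move=> VU [n [a [b e]]]; apply: (eq_factors_add (f := fun m =>
  \sum_i b i (a i m))).
  by move=> m; rewrite e.
by apply: factors_add_sum => i; apply: factors_add_comp VU.
Qed.

Lemma summand_retract M N (a : {linear M -> N}) (b : {linear N -> M}) :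
  (forall m, b (a m) = m) -> is_summand M N.
Proof.
move=> ba; have sK : submod (fun x => b x = 0).
  split=> [|c x y bx b_y]; first exact: linear0.
  by rewrite linearP bx b_y scaler0 addr0.
have [K [k [inj_k kP]]] := submodule_ex sK; exists K.
have bk x : b (k x) = 0 by apply/kP; exists x.
have lf : linear (fun x => x - a (b x)).
  by move=> c x y; rewrite !linearP addrACA scalerDr.
have [r rP] : exists r : {linear N -> K}, forall x, k (r x) = x - a (b x).
  apply: (factor_inj (f := lin_of lf)) => // x; apply/kP.
  by rewrite linearB ba subrr.
have lg : linear (fun x => (b x, r x)).
  by move=> c x y; rewrite !linearP.
exists (lin_of lg); exists (fun z => a z.1 + k z.2) => [x|[m x]] /=.
  by rewrite rP addrC subrK.
rewrite linearD ba bk addr0; congr pair; apply: inj_k.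
by rewrite rP linearD ba bk addr0 addrC addKr.
Qed.

Lemma retract_of_summand M N : is_summand M N ->
  exists (a : {linear M -> N}) (b : {linear N -> M}), forall m, b (a m) = m.
Proof.
move=> [K /mod_iso_inv[f [g [fK gK]]]].
by exists (g \o pinl M K), (fst \o f) => m /=; rewrite gK.
Qed.

End AddClosure.

Section AddOf.
Variables (R : comPzRingType) (L : pzRingType) (phi : {rmorphism R -> L}).
Hypothesis artinL : artin_algebra phi.
Implicit Types (U V M N X Y : fgmod L).

Lemma finlen_fg (Y : rmodType L) : finlen (fun _ : res Y phi => True) ->
  fin_gen Y.
Proof.
have sT : submod (fun _ : res Y phi => True) by [].
case/(finlen_fin_gen sT) => n [g gP]; exists n, g => x.
have [c cE] := (gP x).1 Logic.I.
by exists (fun i => phi (c i)).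
Qed.

(** Middle terms in [extension] are arbitrary modules; this brings them back into [fgmod L], where
    extension-closedness of a subcategory applies. *)
Lemma fin_gen_ses (A B : fgmod L) (E : rmodType L) (f : {linear A -> E})
  (g : {linear E -> B}) : exact_at f g -> fin_gen E.
Proof.
move=> ex; apply: finlen_fg; apply: (finlen_glue (f :=
  lin_of (linear_res (phi := phi) g))) => //.
  have /(finlen_im (lin_of (linear_res (phi := phi) f))) : submod (fun _ :
    res A phi => True) by [].
  move=> /(_ (finlen_res artinL A)); apply: finlen_sub => x [_ /ex[y <-]].
  by exists y.
exact: finlenP.
Qed.

Lemma dirsum_ex n (X : 'I_n -> fgmod L) : exists M : fgmod L,
  is_dirsum (fun i => fgmod_sort (X i)) M.
Proof.
pose X' i := fgmod_sort (X i); have D := is_dirsum_dprod X'.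
suff fgM : fin_gen (dprod_mod X') by exists (FGMod fgM).
apply: finlen_fg.
pose P k (f : res (dprod_mod X') phi) := forall i : 'I_n, (i < k)%N -> f i = 0.
have sP k : submod (P k).
  split=> // a f g f0 g0 i ltik.
  rewrite -[LHS]/((phi a : L^c) *: f i + g i).
  by rewrite f0 // g0 // scaler0 addr0.
suff finP k : (k <= n)%N -> finlen (P (n - k)%N).
  by apply: finlen_sub (finP n (leqnn n)) => f _ i; rewrite subnn.
elim: k => [|k IHk] lekn.
  apply: finlen0 => f f0; apply: functional_extensionality_dep => i.
  by rewrite f0 // subn0.
have ltjn : (n - k.+1 < n)%N by rewrite ltn_subrL; case: (n) lekn.
pose j := Ordinal ltjn.
have lev : linear (fun f : res (dprod_mod X') phi => f j : res (X j) phi) by [].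
apply: (finlen_glue (f := lin_of lev)) => //; last exact: finlenP.
apply: finlen_sub (IHk (ltnW lekn)) => f [f0 fj] i.
rewrite -subSS subSn // ltnS leq_eqVlt => /orP[/eqP ei|]; last exact: f0.
by have -> : i = j by apply: val_inj.
Qed.

(** Writing the identity as a sum of maps through [U] replaces summands of [U^n] by a condition
    stable under sums and composition, in which closure properties of [add U] become computations
    with maps. *)
Lemma add_ofP U M : add_of U M <-> factors_add U (fun m : M => m).
Proof.
split=> [[n [T [[inj [proj [_ _ e]]] /retract_of_summand[a [b ba]]]]]|[n [a [b
  e]]]].
  exists n, (fun i => proj i \o a), (fun i => b \o inj i) => m /=.
  by rewrite -linear_sum -e ba.
have [T D] := dirsum_ex (fun _ : 'I_n => U); exists n, T; split=> //.
have [inj [proj [p1 p0 eT]]] := D.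
have la : linear (fun m => \sum_i inj i (a i m)).
  move=> c x y; rewrite scaler_sumr -big_split; apply: eq_bigr => i _.
  by rewrite !linearP.
have lb : linear (fun t => \sum_i b i (proj i t)).
  move=> c x y; rewrite scaler_sumr -big_split; apply: eq_bigr => i _.
  by rewrite !linearP.
apply: (@summand_retract _ _ _ (lin_of la) (lin_of lb)) => m.
rewrite /= [RHS]e; apply: eq_bigr => i _; congr (b i _).
rewrite linear_sum (bigD1 i) //= p1 big1 ?addr0 // => j ji.
exact: p0.
Qed.

Lemma add_of_self U : add_of U U.
Proof. by apply/add_ofP; apply: (factors_add1 (a := idfun) (b := idfun)). Qed.

Lemma add_of_trans V U M : add_of V U -> add_of U M -> add_of V M.
Proof. by move=> /add_ofP VU /add_ofP UM; apply/add_ofP;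
  apply: factors_add_trans UM. Qed.

Lemma add_of_retract U M N (a : {linear M -> N}) (b : {linear N -> M}) :
  (forall m, b (a m) = m) -> add_of U N -> add_of U M.
Proof.
move=> ba /add_ofP UN; apply/add_ofP.
by apply: eq_factors_add (factors_add_comp a b UN).
Qed.

Lemma add_of_dirsum U n (X : 'I_n -> fgmod L) M :
  is_dirsum (fun i => fgmod_sort (X i)) M -> (forall i, add_of U (X i)) ->
  add_of U M.
Proof.
move=> [inj [proj [_ _ e]]] UX; apply/add_ofP.
apply: (eq_factors_add (f := fun m => \sum_i inj i (proj i m))) => [m|];
  first by rewrite -e.
apply: factors_add_sum => i; have /add_ofP := UX i; exact: factors_add_comp.
Qed.

Lemma add_of_mem n (X : 'I_n -> fgmod L) M i :
  is_dirsum (fun i => fgmod_sort (X i)) M -> add_of M (X i).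
Proof.
move=> [inj [proj [p1 _ _]]]; apply/add_ofP.
by apply: (factors_add1 (a := inj i) (b := proj i)) => m; rewrite p1.
Qed.

Lemma fin_gen_prod M N : fin_gen (M * N)%type.
Proof.
apply: (@fin_gen_ses M N _ (pinl M N) snd) => -[x y] /=.
by split=> [->|[z [_ <-]]//]; exists x.
Qed.

Definition prodfg M N := FGMod (fin_gen_prod M N).

Lemma add_of_prod U M N : add_of U M -> add_of U N -> add_of U (prodfg M N).
Proof.
move=> /add_ofP UM /add_ofP UN; apply/add_ofP.
have := factors_addD (factors_add_comp fst (pinl M N) UM) (factors_add_comp snd
  (pinr M N) UN).
apply: eq_factors_add => -[x y] /=; apply/pair_equal_spec; split.
  exact: addr0.
exact: add0r.
Qed.

Lemma fin_gen_reg : fin_gen ((L^c)^o).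
Proof.
exists 1, (fun=> 1) => x; exists (fun=> x).
by rewrite big_ord1 [_ *: _]mulr1.
Qed.

Definition regfg : fgmod L := FGMod fin_gen_reg.

(** * Projective presentations and exactness properties of Ext over hereditary algebras *)

Hypothesis heredL : hereditary L.

Lemma zero_ex : exists Z : fgmod L, is_zero Z.
Proof.
have [Z [i [p [_ _ e]]]] := dirsum_ex (fun _ : 'I_0 => regfg).
by exists Z => x; rewrite [x]e big_ord0.
Qed.

Lemma hereditary_mod_zero (Z : rmodType L) : is_zero Z -> hereditary_mod Z.
Proof.
move=> Z0 K i inj_i M N g h sg; exists \0 => x.
have -> : x = 0 by apply: inj_i; rewrite linear0; apply: Z0.
by rewrite !linear0.
Qed.

(** [F] is free on the generators. Two of its properties are recorded: its submodules are
    projective, and it lies in [add] of the regular module, the latter for counting indecomposable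
    projectives in [rigid_family_bound]. *)
Lemma cover_span M n (g : 'I_n -> M) : exists (F : fgmod L) (f : {linear F ->
  M}),
  [/\ hereditary_mod F, add_of regfg F & forall x, span g x -> exists y,
    f y = x].
Proof.
elim: n g => [|n IHn] g.
  have [Z Z0] := zero_ex; exists Z, \0; split; first exact: hereditary_mod_zero.
    by apply/add_ofP; exists 0, (fun=> \0), (fun=> \0) => m; rewrite big_ord0.
  by move=> x [c ->]; exists 0; rewrite big_ord0.
have [F [f [hF aF fP]]] := IHn (fun i => g (lift ord0 i)).
have lh : linear (fun z : (prodfg regfg F) => (z.1 : L^c) *: g ord0 + f z.2).
  move=> a [x u] [y v] /=; rewrite linearP scalerDr !scalerA addrACA.
  by rewrite -scalerDl.
exists (prodfg regfg F), (lin_of lh); split.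
- by apply: hereditary_mod_prod => //; apply: heredL.
- by apply: add_of_prod => //; apply: add_of_self.
- move=> x [c ->]; rewrite big_ord_recl.
  have [|y <-] := fP (\sum_i c (lift ord0 i) *: g (lift ord0 i)).
    by exists (fun i => c (lift ord0 i)).
  by exists (c ord0, y).
Qed.

Lemma cover_ex M : exists (F : fgmod L) (f : {linear F -> M}),
  [/\ hereditary_mod F, add_of regfg F & surj f].
Proof.
have [n [g gP]] := fgmod_fin_gen M.
have [F [f [hF aF fP]]] := cover_span g.
by exists F, f; split=> // x; apply/fP/gP.
Qed.

Lemma kernel_ex M (N : rmodType L) (f : {linear M -> N}) :
  exists (K : fgmod L) (i : {linear K -> M}), injective i /\ exact_at i f.
Proof.
have sK : submod (fun x => f x = 0).
  split=> [|c x y fx fy]; first exact: linear0.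
  by rewrite linearP fx fy scaler0 addr0.
by have [K [k [inj_k kP]]] := submodule_fg artinL sK; exists K, k.
Qed.

Lemma presentation_ex M : exists (K F : fgmod L) (i : {linear K -> F})
    (p : {linear F -> M}),
  [/\ short_exact i p, projective K, hereditary_mod F & add_of regfg F].
Proof.
have [F [p [hF aF sp]]] := cover_ex M.
have [K [i [inj_i ex]]] := kernel_ex p.
by exists K, F, i, p; split=> //; apply: hF inj_i.
Qed.

(** Ext(X, -) is right exact: a map from the projective syzygy to [C'] lifts to [C], extends to [F]
    there, and is carried back by [q]. *)
Lemma Ext1_quot X (C C' : rmodType L) (q : {linear C -> C'}) :
  surj q -> Ext1_eq0 X C -> Ext1_eq0 X C'.
Proof.
move=> sq ext0; have [K [F [i [p [ip projK hF _]]]]] := presentation_ex X.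
apply: (extend_Ext1 (hereditary_mod_projective hF) ip) => h.
have [k kP] := projK C C' q h sq; have [k' k'P] := Ext1_extend k ext0 ip.
by exists (q \o k') => x /=; rewrite k'P kP.
Qed.

(** The preimage [F'] of [X'] in [F] is projective and has the same syzygy [K], so an extension of a
    map from [K] to [F] restricts to [F']. *)
Lemma Ext1_sub X (X' C : rmodType L) (j : {linear X' -> X}) :
  injective j -> Ext1_eq0 X C -> Ext1_eq0 X' C.
Proof.
move=> inj_j ext0; have [K [F [i [p [ip projK hF _]]]]] := presentation_ex X.
pose G x := exists y, j y = p x.
have sG : submod G.
  split; first by exists 0; rewrite !linear0.
  by move=> a x y [u uE] [v vE]; exists (a *: u + v); rewrite !linearP uE vE.
have [F' [f [inj_f fP]]] := submodule_ex sG.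
have hF' := hereditary_mod_sub inj_f hF.
have [q qP] : exists q : {linear F' -> X'}, forall x, j (q x) = p (f x).
  by apply: (factor_inj (f := p \o f)) => // x; apply/fP; exists x.
case: (ip) => inj_i ex_i sp.
have [i' i'P] : exists i' : {linear K -> F'}, forall x, f (i' x) = i x.
  apply: factor_inj => // x; apply/fP; exists 0; rewrite linear0.
  by apply/esym/ex_i; exists x.
apply: (extend_Ext1 (i := i') (p := q) (hereditary_mod_projective hF')).
  split.
  - by move=> x y /(congr1 f); rewrite !i'P => /inj_i.
  - move=> x; split=> [qx|[k <-]].
      have /ex_i[k kE] : p (f x) = 0 by rewrite -qP qx linear0.
      by exists k; apply: inj_f; rewrite i'P.
    apply: inj_j; rewrite qP i'P linear0; apply/ex_i; by exists k.
  - move=> y; have [x xE] := sp (j y).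
    have /fP[z zE] : G x by exists y.
    by exists z; apply: inj_j; rewrite qP zE.
move=> h; have [k kP] := Ext1_extend h ext0 ip.
by exists (k \o f) => x /=; rewrite i'P kP.
Qed.

(** This is the stretch Hom(U,A) -> Hom(U,I) -> Ext(U,K) -> Ext(U,A) of the long exact sequence:
    extend into [A], then subtract a lift of the induced map [U -> I] to land in [K]. *)
Lemma Ext1_kernel U (K A I : rmodType L) (i : {linear K -> A})
    (q : {linear A -> I}) :
  injective i -> exact_at i q -> Ext1_eq0 U A ->
  (forall u : {linear U -> I}, exists v : {linear U -> A}, forall x,
    q (v x) = u x) ->
  Ext1_eq0 U K.
Proof.
move=> inj_i ex_i ext0 lift; have [W [F [w [p [wp projW hF _]]]]] :=
  presentation_ex U.
apply: (extend_Ext1 (hereditary_mod_projective hF) wp) => h.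
have [h' h'P] := Ext1_extend (i \o h) ext0 wp.
case: wp => inj_w ex_w sp.
have [u uP] : exists u : {linear U -> I}, forall x, u (p x) = q (h' x).
  apply: (factor_surj (f := q \o h')) => // x /ex_w[y <-] /=.
  by rewrite h'P; apply/ex_i; exists (h y).
have [v vP] := lift u.
have lf : linear (fun x => h' x - v (p x)).
  by move=> c x y; rewrite !linearP addrACA scalerDr.
have [g gP] : exists g : {linear F -> K}, forall x, i (g x) = h' x - v (p x).
  apply: (factor_inj (f := lin_of lf)) => // x; apply/ex_i.
  by rewrite linearB vP uP subrr.
exists g => x; apply: inj_i; rewrite gP h'P /=.
have -> : p (w x) = 0 by apply/ex_w; exists x.
by rewrite linear0 subr0.
Qed.

Lemma Ext1_add_l U M (C : rmodType L) : add_of U M -> Ext1_eq0 U C ->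
  Ext1_eq0 M C.
Proof.
move=> /add_ofP[n [a [b e]]] ext0; apply/Ext1_sectionP => E i p ip.
have /choice[v vP] k := Ext1_lift (b k) ext0 ip.
have lf : linear (fun m => \sum_i v i (a i m)).
  move=> c x y; rewrite scaler_sumr -big_split; apply: eq_bigr => k _.
  by rewrite !linearP.
exists (lin_of lf) => m; rewrite [RHS]e linear_sum.
by apply: eq_bigr => k _; apply: vP.
Qed.

Lemma Ext1_add_r U V M : add_of V M -> Ext1_eq0 U V -> Ext1_eq0 U M.
Proof.
move=> /add_ofP[n [a [b e]]] ext0.
have [W [F [w [p [wp projW hF _]]]]] := presentation_ex U.
apply: (extend_Ext1 (hereditary_mod_projective hF) wp) => h.
have /choice[v vP] k := Ext1_extend (a k \o h) ext0 wp.
have lf : linear (fun m => \sum_i b i (v i m)).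
  move=> c x y; rewrite scaler_sumr -big_split; apply: eq_bigr => k _.
  by rewrite !linearP.
exists (lin_of lf) => m; rewrite [RHS]e /=.
by apply: eq_bigr => k _; rewrite vP.
Qed.

End AddOf.

(** * Cokernels of maps in add U for rigid U *)

Section Cok.
Variables (R : comPzRingType) (L : pzRingType) (phi : {rmorphism R -> L}).
Hypothesis artinL : artin_algebra phi.
Implicit Types (U V M N X Y K I : fgmod L).

Lemma phi_linear (X : rmodType L) r : linear (fun x : X => (phi r : L^c) *: x).
Proof.
move=> a x y; rewrite scalerDr !scalerA; congr (_ *: _ + _).
exact/esym/(phi_central artinL).
Qed.

Definition phi_scale (X : rmodType L) r : {linear X -> X} :=
  lin_of (@phi_linear X r).

(** One copy of [U] is taken for each generator of Hom(U,Y) over [R]; the coefficients of a map act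
    as endomorphisms of [U], since [phi] is central. *)
Lemma right_approx U Y : exists (A : fgmod L) (q : {linear A -> Y}),
  add_of U A /\ forall u : {linear U -> Y}, exists v : {linear U -> A},
    forall x, q (v x) = u x.
Proof.
have [n [h hP]] := hom_fin_gen artinL U Y.
have [A D] := dirsum_ex artinL (fun _ : 'I_n => U).
have aA : add_of U A by apply: (add_of_dirsum artinL D) => _;
  apply: add_of_self artinL _.
have [inj [proj [p1 p0 e]]] := D.
have lq : linear (fun t => \sum_i h i (proj i t)).
  move=> c x y; rewrite scaler_sumr -big_split; apply: eq_bigr => i _.
  by rewrite !linearP.
exists A, (lin_of lq); split=> // u; have [c uE] := hP u.
have lv : linear (fun t => \sum_i inj i (phi_scale U (c i) t)).
  move=> a x y; rewrite scaler_sumr -big_split; apply: eq_bigr => i _.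
  by rewrite !linearP.
exists (lin_of lv) => x; rewrite uE; apply: eq_bigr => i _ /=.
rewrite linear_sum (bigD1 i) //= p1 big1 => [|j ji]; last exact: p0.
by rewrite addr0 linearZZ.
Qed.

(** The kernel of the first projection is the direct sum of the remaining terms, so finite direct
    sums are iterated extensions. *)
Lemma ext_closed_dirsum (C : subcat L) :
  (forall M N, C M -> mod_iso M N -> C N) -> (forall Z : fgmod L, is_zero Z ->
    C Z) ->
  ext_closed C ->
  forall n (X : 'I_n -> fgmod L) M, (forall i, C (X i)) ->
    is_dirsum (fun i => fgmod_sort (X i)) M -> C M.
Proof.
move=> isoC C0 extC; elim=> [|n IHn] X M CX [inj [proj [p1 p0 e]]].
  by apply: C0 => x; rewrite [x]e big_ord0.
have [K [k [inj_k ex_k]]] := kernel_ex artinL (proj ord0).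
apply: (extC K M (X ord0) k (proj ord0)) => //.
  by split=> // x; exists (inj ord0 x).
apply: (IHn (fun i => X (lift ord0 i))) => //.
have injK i : exists f : {linear X (lift ord0 i) -> K},
    forall x, k (f x) = inj (lift ord0 i) x.
  by apply: factor_inj => // x; apply/ex_k/p0.
exists (fun i => sval (cid (injK i))), (fun i => proj (lift ord0 i) \o k).
split=> [i x|i j ij x|m] /=.
- by case: cid => f /= fP; rewrite fP p1.
- case: cid => f /= fP; rewrite fP p0 //.
- apply: inj_k; rewrite [LHS]e big_ord_recl linear_sum.
  have -> : proj ord0 (k m) = 0 by apply/ex_k; exists m.
  rewrite linear0 add0r; apply: eq_bigr => i _.
  by case: cid => f /= fP; rewrite fP.
Qed.

Lemma image_ex (X : fgmod L) Y (f : {linear X -> Y}) :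
  exists (I : fgmod L) (p : {linear X -> I}) (i : {linear I -> Y}),
  [/\ surj p, injective i & forall x, i (p x) = f x].
Proof.
have sI : submod (im_sub f (fun _ => True)) by apply: submod_im.
have [I [i [inj_i iP]]] := submodule_fg artinL sI.
have [p pP] : exists p : {linear X -> I}, forall x, i (p x) = f x.
  by apply: factor_inj => // x; apply/iP; exists x.
exists I, p, i; split=> // y; have /iP[x _ xE] : exists y',
  i y' = i y by exists y.
by exists x; apply: inj_i; rewrite pP.
Qed.

Hypothesis heredL : hereditary L.

Lemma add_of_ses U (A E B : fgmod L) (i : {linear A -> E}) (p : {linear E ->
  B}) :
  short_exact i p -> add_of U A -> add_of U B -> Ext1_eq0 B A -> add_of U E.
Proof.
move=> ip aA aB /Ext1_sectionP/(_ E i p ip)[s sP].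
case: ip => inj_i ex_i sp.
have lf : linear (fun e => e - s (p e)).
  by move=> c x y; rewrite !linearP addrACA scalerDr.
have [r rP] : exists r : {linear E -> A}, forall e, i (r e) = e - s (p e).
  apply: (factor_inj (f := lin_of lf)) => // e; apply/ex_i.
  by rewrite linearB sP subrr.
move: aA aB => /(add_ofP artinL)aA /(add_ofP artinL)aB; apply/(add_ofP artinL).
apply: eq_factors_add (factors_addD (factors_add_comp r i aA) (factors_add_comp
  p s aB)) => e /=.
by rewrite rP subrK.
Qed.

(** * Resolutions and closure properties of [cok U] for rigid [U] *)

Section RigidCok.
Variable U : fgmod L.
Hypothesis rigidU : rigid U.

Lemma Ext1_add A B : add_of U A -> add_of U B -> Ext1_eq0 A B.
Proof.
by move=> aA aB; apply: (Ext1_add_l artinL aA);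
  apply: (Ext1_add_r artinL heredL aB).
Qed.

(* A right add U-approximation of I has a kernel K with Ext(U, K) = 0, hence
   Ext(I, K) = 0 as I embeds into an object of add U. *)
Lemma add_of_image (A B I : fgmod L) (p : {linear A -> I}) (i : {linear I ->
  B}) :
  add_of U A -> add_of U B -> surj p -> injective i -> add_of U I.
Proof.
move=> aA aB sp inj_i.
have [A' [q [aA' qP]]] := right_approx U I.
have [K [k [inj_k ex_k]]] := kernel_ex artinL q.
have sq : surj q.
  move=> y; have [x <-] := sp y; have /(add_ofP artinL)[n [a [b e]]] := aA.
  have /choice[v vP] j := qP (p \o b j).
  exists (\sum_j v j (a j x)); rewrite [X in p X]e !linear_sum.
  by apply: eq_bigr => j _; apply: vP.
have UK : Ext1_eq0 U K.
  by apply: (Ext1_kernel artinL heredL inj_k ex_k) => //; apply: Ext1_add =>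
    //; apply: add_of_self artinL _.
have IK : Ext1_eq0 I K.
  by apply: (Ext1_sub artinL heredL inj_i); apply: (Ext1_add_l artinL aB).
have /Ext1_sectionP/(_ A' k q)[//|s sP] := IK.
exact: (add_of_retract artinL sP).
Qed.

Lemma resolution_cok U1 U0 (M : fgmod L) (i : {linear U1 -> U0}) (p :
  {linear U0 -> M}) :
  exact_at i p -> surj p -> add_of U U1 -> add_of U U0 -> cok U M.
Proof. by move=> ex sp a1 a0; exists U1, U0, i; split=> //; exists p. Qed.

Lemma cok_resolution M : cok U M ->
  exists (U1 U0 : fgmod L) (i : {linear U1 -> U0}) (p : {linear U0 -> M}),
    [/\ short_exact i p, add_of U U1 & add_of U U0].
Proof.
move=> [A [B [f [aA aB [p ex sp]]]]].
have [K [k [inj_k ex_k]]] := kernel_ex artinL p.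
have [g gP] : exists g : {linear A -> K}, forall x, k (g x) = f x.
  by apply: factor_inj => // x; apply/ex_k/ex; exists x.
exists K, B, k, p; split=> //; apply: (add_of_image aA aB _ inj_k (p := g)).
move=> y; have /ex[x xE] : p (k y) = 0 by apply/ex_k; exists y.
by exists x; apply: inj_k; rewrite gP.
Qed.

Lemma add_of_cok M : add_of U M -> cok U M.
Proof.
move=> aM; apply: (@resolution_cok M M M \0 idfun) => // y; last by exists y.
by split=> [/= ->|[x <-]//]; exists 0.
Qed.

Lemma Ext1_cok A M : add_of U A -> cok U M -> Ext1_eq0 A M.
Proof.
move=> aA [B [C [f [_ aC [p _ sp]]]]].
by apply: (Ext1_quot artinL heredL sp); apply: Ext1_add.
Qed.

(** [V] is the preimage of the image of [f] in the term [U0] of a resolution of [Y]. It is the image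
    of [X0 * U1 -> U0], formed from a lift of [f] and from [i], hence lies in [add U]. So
    [im f = V / U1] and [coker f = U0 / V], which serves both closure properties. *)
Lemma cok_image_coker X Y (f : {linear X -> Y}) : cok U X -> cok U Y ->
  exists (V U1 U0 : fgmod L) (j : {linear V -> U0}) (i : {linear U1 -> V}) (p :
    {linear U0 -> Y}),
  [/\ [/\ add_of U V, add_of U U1 & add_of U U0], short_exact (j \o i) p,
    injective j
    & forall x, (exists y, j y = x) <-> (exists z, f z = p x)].
Proof.
move=> /cok_resolution[X1 [X0 [k [q [[_ _ sq] aX1 aX0]]]]].
move=> /cok_resolution[U1 [U0 [i [p [ip a1 a0]]]]].
have [v vP] := Ext1_lift (f \o q) (Ext1_add aX0 a1) ip.
case: (ip) => inj_i ex_i sp.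
have lg : linear (fun z : prodfg artinL X0 U1 => v z.1 + i z.2).
  by move=> c x y; rewrite !linearP scalerDr addrACA.
have [V [g [j [sg inj_j jP]]]] := image_ex (lin_of lg).
have aV : add_of U V by apply: (add_of_image _ a0 sg inj_j); apply: add_of_prod.
exists V, U1, U0, j, (g \o pinr X0 U1), p; split=> //.
  have ji x : j (g (0, x)) = i x by rewrite jP /= linear0 add0r.
  split=> //; first by move=> x y /=; rewrite !ji => /inj_i.
  move=> y; split=> [/ex_i[x <-]|[x <-]]; first by exists x; rewrite /= ji.
  by apply/ex_i; exists x; rewrite /= ji.
move=> x; split=> [[y <-]|[z fz]].
  have [[u w] <-] := sg y; rewrite jP /= linearD vP.
  have -> : p (i w) = 0 by apply/ex_i; exists w.
  by rewrite addr0; exists (q u).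
have [u uz] := sq z.
have /ex_i[w wE] : p (x - v u) = 0 by rewrite linearB vP /= uz fz subrr.
by exists (g (u, w)); rewrite jP /= wE addrC subrK.
Qed.

Lemma cok_im_closed : im_closed (cok U).
Proof.
move=> X Y M f cX cY [q [k [sq inj_k fE]]].
have [V [U1 [U0 [j [i [p [[aV a1 a0] [inj_ji ex sp] inj_j jP]]]]]]] :=
  cok_image_coker f cX cY.
have [g gP] : exists g : {linear V -> M}, forall x, k (g x) = p (j x).
  apply: (factor_inj (f := p \o j)) => // x /=.
  have /jP[z zE] : exists y, j y = j x by exists x.
  by exists (q z); rewrite -fE.
apply: (@resolution_cok U1 V M i g) => //.
  move=> y; split=> [gy|[x <-]].
    have /ex[x xE] : p (j y) = 0 by rewrite -gP gy linear0.
    by exists x; apply: inj_j.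
  apply: inj_k; rewrite gP linear0; apply/ex; by exists x.
move=> m; have [x xm] := sq m; have [y yE] := sp (f x).
have /jP[z zE] : exists z, f z = p y by exists x.
by exists z; apply: inj_k; rewrite gP zE yE fE xm.
Qed.

Lemma cok_coker_closed : coker_closed (cok U).
Proof.
move=> X Y M f cX cY [q ex_q sq].
have [V [U1 [U0 [j [i [p [[aV a1 a0] [inj_ji ex sp] inj_j jP]]]]]]] :=
  cok_image_coker f cX cY.
apply: (@resolution_cok V U0 M j (q \o p)) => //.
  by move=> y; split=> [/ex_q/jP//|/jP/ex_q].
by move=> m; have [y <-] := sq m; have [x <-] := sp y; exists x.
Qed.

(** Horseshoe lemma: as Ext(D0,A) vanishes, [pD] lifts to [B], so [A0 * D0] covers [B]. The kernel
    is an extension of [D1] by [A1], which splits and stays in [add U]. *)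
Lemma cok_ext_closed : ext_closed (cok U).
Proof.
move=> A B D f g [inj_f ex_f sg] cA cD.
have [A1 [A0 [iA [pA [[inj_iA ex_A spA] a1 a0]]]]] := cok_resolution cA.
have [D1 [D0 [iD [pD [[inj_iD ex_D spD] d1 d0]]]]] := cok_resolution cD.
have fg : short_exact f g by [].
have [v vP] := Ext1_lift pD (Ext1_cok d0 cA) fg.
pose W := prodfg artinL A0 D0.
have lg : linear (fun z : W => f (pA z.1) + v z.2).
  by move=> c x y; rewrite !linearP scalerDr addrACA.
pose h := lin_of lg.
have [K [k [inj_k ex_k]]] := kernel_ex artinL h.
have pk z : h (k z) = 0 by apply/ex_k; exists z.
have gf x : g (f x) = 0 by apply/ex_f; exists x.
have [s sP] : exists s : {linear K -> D1}, forall z, iD (s z) = (k z).2.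
  apply: (factor_inj (f := snd \o k)) => // z; apply/ex_D => /=.
  by have := congr1 g (pk z); rewrite linearD gf add0r vP linear0.
have [t tP] : exists t : {linear A1 -> K}, forall z, k (t z) = (iA z, 0).
  apply: (factor_inj (f := pinl A0 D0 \o iA)) => // z; apply/ex_k => /=.
  have -> : pA (iA z) = 0 by apply/ex_A; exists z.
  by rewrite !linear0 addr0.
apply: (@resolution_cok K W B k h) => //; last by apply: add_of_prod.
  move=> b; have [y yE] := spD (g b).
  have /ex_f[a aE] : g (b - v y) = 0 by rewrite linearB vP yE subrr.
  by have [x xE] := spA a; exists (x, y); rewrite /= xE aE subrK.
apply: (add_of_ses (i := t) (p := s) _ a1 d1 (Ext1_add d1 a1)); split.
- by move=> x y /(congr1 k); rewrite !tP => -[/inj_iA].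
- move=> z; split=> [sz|[x <-]]; last first.
    by apply: inj_iD; rewrite sP tP linear0.
  have kz2 : (k z).2 = 0 by rewrite -sP sz linear0.
  have /ex_A[w wE] : pA (k z).1 = 0.
    by apply: inj_f; rewrite linear0; have := pk z;
      rewrite /= kz2 linear0 addr0.
  by exists w; apply: inj_k; rewrite tP wE -kz2; case: (k z).
- move=> w; have /ex_f[a aE] : g (v (iD w)) = 0.
    by rewrite vP; apply/ex_D; exists w.
  have [x xE] := spA a.
  have /ex_k[z zE] : h (- x, iD w) = 0 by rewrite /= !linearN xE aE addNr.
  by exists z; apply: inj_iD; rewrite sP zE.
Qed.

Lemma cok_iso M N : cok U M -> mod_iso M N -> cok U N.
Proof.
move=> [A [B [f [aA aB [p ex sp]]]]] /mod_iso_inv[g [h [gK hK]]].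
exists A, B, f; split=> //; exists (g \o p).
  move=> y /=; split=> [|/ex->]; last exact: linear0.
  by rewrite -(linear0 g) => /(can_inj gK)/ex.
by move=> y; have [x xE] := sp (h y); exists x; rewrite /= xE hK.
Qed.

(** Closure under summands comes from closure under images, a summand being the image of the
    idempotent [a \o b]. *)
Lemma cok_subcategory : subcategory (cok U).
Proof.
split; first exact: cok_iso.
  apply: ext_closed_dirsum; [exact: cok_iso| |exact: cok_ext_closed].
  move=> Z Z0; apply/add_of_cok/(add_ofP artinL).
  by exists 0, (fun=> \0), (fun=> \0) => z; rewrite big_ord0.
move=> A M cM /retract_of_summand[a [b ba]].
apply: (cok_im_closed (f := a \o b) cM cM); exists b, a; split=> //.
  by move=> x; exists (a x).
exact: can_inj ba.
Qed.

(** The resolution of an Ext-projective object splits because its kernel [U1] belongs to [cok U]. *)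
Lemma cok_ext_projective : ext_projective (cok U) = add_of U.
Proof.
apply/funext => M; apply/propext; split=> [[cM ext0]|aM]; last first.
  by split=> [|Y cY]; [apply: add_of_cok | apply: Ext1_cok].
have [U1 [U0 [i [p [ip a1 a0]]]]] := cok_resolution cM.
have /Ext1_sectionP/(_ _ i p ip)[s sP] := ext0 _ (add_of_cok a1).
exact: (add_of_retract artinL sP).
Qed.

Lemma cok_enough : enough_ext_projectives (cok U).
Proof.
move=> X /cok_resolution[U1 [U0 [i [p [ip a1 a0]]]]].
by exists U1, U0, i, p; rewrite cok_ext_projective; split=> //;
  apply: add_of_cok.
Qed.

Lemma cok_ice_p : ice_p (cok U).
Proof.
split; last exact: cok_enough; split.
- exact: cok_subcategory.
- exact: cok_im_closed.
- exact: cok_coker_closed.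
- exact: cok_ext_closed.
Qed.

Lemma cok_progenerator : ext_progenerator (cok U) U.
Proof.
split; [exact/add_of_cok/(add_of_self artinL)|by rewrite cok_ext_projective|].
exact: cok_enough.
Qed.

End RigidCok.

Lemma progenerator_rigid (C : subcat L) P : ext_progenerator C P -> rigid P.
Proof.
move=> [CP aP _]; have [_ ext0] : ext_projective C P.
  by rewrite -aP; apply: add_of_self artinL _.
exact: ext0.
Qed.

(** An Ext-projective cover of [M] and one of its kernel splice to a presentation of [M] in
    [add P]. *)
Lemma progenerator_cok (C : subcat L) P :
  coker_closed C -> ext_progenerator C P -> cok P = C.
Proof.
move=> cokC [CP aP enC]; apply/funext => M; apply/propext; split.
  move=> [A [B [f [aA aB cM]]]]; apply: cokC cM.
    by move: aA; rewrite aP => -[].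
  by move: aB; rewrite aP => -[].
move=> CM; have [Y [P0 [f [g [[_ ex sg] pP0 CY]]]]] := enC _ CM.
have [Y' [P1 [f' [g' [[_ _ sg'] pP1 _]]]]] := enC _ CY.
exists P1, P0, (f \o g'); rewrite aP; split=> //; exists g => //.
move=> y; split=> [/ex[x <-]|[x <-]].
  by have [z <-] := sg' x; exists z.
by apply/ex; exists (g' x).
Qed.

End Cok.

(** * Krull-Schmidt *)

Section Iso.
Variable S : pzRingType.
Implicit Types M N P Q : lmodType S.

Lemma mod_iso_trans M N P : mod_iso M N -> mod_iso N P -> mod_iso M P.
Proof. by move=> [f fb] [g gb]; exists (g \o f); apply: bij_comp. Qed.

Lemma lin_inv M N (f : {linear M -> N}) : bijective f ->
  exists g : {linear N -> M}, cancel f g /\ cancel g f.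
Proof.
move=> [g fK gK]; have lg : linear g by apply: can2_linear fK gK.
by exists (lin_of lg).
Qed.

Lemma linear_iter M (f : {linear M -> M}) n : linear (iter n f).
Proof. by elim: n => // n IHn a x y; rewrite !iterS IHn linearP. Qed.
End Iso.

Section KrullSchmidt.
Variables (R : comPzRingType) (L : pzRingType) (phi : {rmorphism R -> L}).
Hypothesis artinL : artin_algebra phi.
Implicit Types (U V M N X Y K I : fgmod L).

Definition flen Y := len (fun _ : res Y phi => True).

Lemma flen_ses X Y N (i : {linear X -> Y}) (p : {linear Y -> N}) :
  short_exact i p -> flen Y = (flen X + flen N)%N.
Proof.
move=> [inj_i ex sp]; have sT Z : submod (fun _ : res Z phi => True) by [].
rewrite /flen (len_add (lin_of (linear_res (phi :=
  phi) p)) (sT Y) (finlen_res artinL Y)).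
rewrite -(len_inj (f := lin_of (linear_res (phi :=
  phi) i)) (sT X) (finlen_res artinL X)); last first.
  by move=> x _ /= ix; apply: inj_i; rewrite ix linear0.
congr (_ + _)%N; congr len; apply/funext => y; apply/propext; split=> //.
- by case=> _ /ex[x <-]; exists x.
- by case=> x _ <-; split=> //; apply/ex; exists x.
- by move=> _; have [x <-] := sp y; exists x.
Qed.

Lemma flen0_zero X : flen X = 0%N -> is_zero X.
Proof.
move=> X0 x; apply: (@len_eq _ (res X phi) (fun=> True) (fun x => x = 0)) => //.
- exact: finlen_res.
- by split=> // a u v -> ->; rewrite scaler0 addr0.
- by rewrite [len _]X0.
Qed.

Lemma flen_inj_bij X Y (f : {linear X -> Y}) :
  injective f -> (flen Y <= flen X)%N -> bijective f.
Proof.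
move=> inj_f; have sT : submod (fun _ : res X phi => True) by [].
rewrite {2}/flen -(len_inj (f := lin_of (linear_res (phi :=
  phi) f)) sT (finlen_res artinL X)); last first.
  by move=> x _ /= fx; apply: inj_f; rewrite fx linear0.
move=> le; apply: inj_surj_bij => // y.
have [] // := len_eq (finlen_res artinL Y) (submod_im _ sT) _ le (x := y).
by move=> x _ <-; exists x.
Qed.

Lemma flen_surj_bij X Y (f : {linear X -> Y}) :
  surj f -> (flen X <= flen Y)%N -> bijective f.
Proof.
move=> sf; have [K [k [inj_k ex_k]]] := kernel_ex artinL f.
have kf : short_exact k f by [].
rewrite (flen_ses kf) -[leqRHS]add0n leq_add2r leqn0 => /eqP/flen0_zero K0.
apply: inj_surj_bij => //; apply: inj_lin0 => x /ex_k[y <-].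
by rewrite (K0 y) linear0.
Qed.

(** The kernels of the iterates stop growing at some [n], so [g = f^(n+1)] has the same kernel as
    [g^2] and is injective on its image. The exponent is positive so that the kernel of [f] lies in
    that of [g]. *)
Lemma fitting_image X (f : {linear X -> X}) :
  exists n (I : fgmod L) (p : {linear X -> I}) (i : {linear I -> X}),
  [/\ surj p, injective i, forall x, i (p x) = iter n.+1 f x
    & bijective (p \o i)].
Proof.
pose k n := len (fun x : res X phi => iter n f x = 0).
have finX (P : res X phi -> Prop) : finlen P := finlenP artinL P.
have exk : exists l, `[<exists n, l = k n>] by exists (k 0); apply/asboolP;
  exists 0.
have ubk l : `[<exists n, l = k n>] -> (l <= flen X)%N.
  by move/asboolP => [n ->]; apply: len_le.
case: (ex_maxnP exk ubk) => l /asboolP[n ->] maxl.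
have ker_n m x : (n <= m)%N -> iter m f x = 0 -> iter n f x = 0.
  move=> lenm; apply: (@len_eq _ (res X phi) (fun x =>
    iter m f x = 0) (fun x => iter n f x = 0)) => //.
  - split; first exact: (linear0 (lin_of (linear_iter f n))).
    by move=> a u v un vn; rewrite [LHS](linear_iter f n) un vn scaler0 addr0.
  - move=> u un; rewrite -(subnK lenm) iterD un.
    exact: (linear0 (lin_of (linear_iter f _))).
  - by apply: maxl; apply/asboolP; exists m.
have [g gE] : exists g : {linear X -> X}, forall x, g x = iter n.+1 f x.
  by exists (lin_of (linear_iter f n.+1)).
have gg x : g (g x) = 0 -> g x = 0.
  rewrite !gE -iterD => /ker_n fx.
  by rewrite iterS fx ?linear0 // -addSnnS leq_addl.
have [I [p [i [sp inj_i ip]]]] := image_ex artinL g.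
exists n, I, p, i; split=> // [x|]; first by rewrite ip gE.
apply: flen_inj_bij => //; apply: inj_lin0 => y /= piy.
have [x xy] := sp y; apply: inj_i; rewrite linear0 -xy ip; apply: gg.
have gx : g x = i y by rewrite -ip xy.
by rewrite gx -[LHS]ip piy linear0.
Qed.

Lemma fitting X (f : {linear X -> X}) : indecomposable X ->
  bijective f \/ exists n, forall x, iter n f x = 0.
Proof.
move=> [_ indX]; have [n [I [p [i [sp inj_i ifp bij_pi]]]]] := fitting_image f.
have [g gE] : exists g : {linear X -> X}, forall x, g x = iter n.+1 f x.
  by exists (lin_of (linear_iter f n.+1)).
have ip x : i (p x) = g x by rewrite gE ifp.
have [K [j [inj_j ex_j]]] := kernel_ex artinL g.
have lh : linear (fun z : K * I => j z.1 + i z.2).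
  by move=> c x y; rewrite !linearP scalerDr addrACA.
have bij_h : bijective (lin_of lh).
  apply: inj_surj_bij.
    apply: inj_lin0 => -[u v] /= juv.
    have gj y : g (j y) = 0 by apply/ex_j; exists y.
    have v0 : v = 0.
      apply: (bij_inj bij_pi); apply: inj_i; rewrite /= ip linear0 linear0
        linear0.
      by rewrite -[i v](addKr (j u)) juv addr0 linearN gj oppr0.
    by rewrite v0; congr pair; apply: inj_j; move: juv;
      rewrite v0 !linear0 addr0.
  move=> x; have [q _ piq] := bij_pi.
  have /ex_j[u uE] : g (x - i (q (p x))) = 0.
    have := piq (p x) => /= e; apply/eqP.
    by rewrite linearB subr_eq0 -(ip (i _)) e ip.
  by exists (u, q (p x)); rewrite /= uE subrK.
have : mod_iso X (K * I)%type by apply: mod_iso_sym; exists (lin_of lh).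
case/indX => [K0|I0].
  left; apply: flen_inj_bij => //; apply: inj_lin0 => x fx.
  have /ex_j[u <-] : g x = 0.
    by rewrite gE iterSr fx; apply: (linear0 (lin_of (linear_iter f n))).
  by rewrite (K0 u) linear0.
by right; exists n.+1 => x; rewrite -gE -ip (I0 (p x)) linear0.
Qed.

(** The endomorphism ring is local: if [f] is not invertible it is nilpotent, and the kernel of
    [g = 1 - f] consists of fixed points of [f]. *)
Lemma local_sum2 X (f g : {linear X -> X}) : indecomposable X ->
  (forall x, f x + g x = x) -> bijective f \/ bijective g.
Proof.
move=> indX fg; have [|[n fn]] := fitting f indX; first by left.
right; apply: flen_inj_bij => //; apply: inj_lin0 => x gx.
have fx : f x = x by rewrite -{2}(fg x) gx addr0.
by rewrite -(fn x); elim: (n) => //= m <-.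
Qed.

Lemma local_sum X n (f : 'I_n -> {linear X -> X}) (h : X -> X) :
  indecomposable X -> bijective h -> (forall x, h x = \sum_i f i x) ->
  exists i, bijective (f i).
Proof.
move=> indX; elim: n f h => [|n IHn] f h bij_h hE.
  case: (indX) => [[]] x; apply: (bij_inj bij_h).
  by rewrite !hE !big_ord0.
have lh : linear h.
  move=> a x y; rewrite !hE scaler_sumr -big_split.
  by apply: eq_bigr => i _; rewrite linearP.
have [q [hK qK]] := lin_inv (bij_h : bijective (lin_of lh)).
have lr : linear (fun x => \sum_(i < n) f (lift ord0 i) x).
  move=> a x y; rewrite scaler_sumr -big_split.
  by apply: eq_bigr => i _; rewrite linearP.
have bij_q : bijective q by exists h.
have [|bf|bf] := @local_sum2 X (f ord0 \o q) (lin_of lr \o q) indX.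
- by move=> x /=; rewrite -{3}[x]qK /= hE big_ord_recl.
- exists ord0; apply: (eq_bij (f := (f ord0 \o q) \o h)).
    by apply: bij_comp => //; exists q.
  by move=> x /=; rewrite [q _]hK.
- have [|//|i bi] := IHn (fun i => f (lift ord0 i)) (lin_of lr).
    apply: (eq_bij (f := (lin_of lr \o q) \o h)).
      by apply: bij_comp => //; exists q.
    by move=> x /=; rewrite [q _]hK.
  by exists (lift ord0 i).
Qed.

Lemma iso_of_retract X Y (a : {linear X -> Y}) (b : {linear Y -> X}) :
  ~ is_zero X -> indecomposable Y -> bijective (b \o a) -> mod_iso X Y.
Proof.
move=> X0 [_ indY] bij_ba; have [q [baK qK]] := lin_inv bij_ba.
have [|K iso] := @summand_retract _ X Y a (q \o b) => [m|]; first exact: baK.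
have [//|K0] := indY _ _ iso; case: (mod_iso_sym iso) => f fb.
exists (f \o pinl X K); apply: bij_comp => //; exists fst => // -[x y].
by rewrite /= (K0 y).
Qed.

(** Existence of decompositions into indecomposables, as an induction principle; the recursion is on
    length over [R]. *)
Lemma fg_ind (P : fgmod L -> Prop) :
  (forall M, is_zero M -> P M) -> (forall M, indecomposable M -> P M) ->
  (forall A B M : fgmod L, mod_iso M (A * B)%type -> P A -> P B -> P M) ->
  forall M, P M.
Proof.
move=> P0 P1 PD M; have [n] := ubnP (flen M); elim: n M => // n IHn M ltMn.
have [/P0//|M0] := pselect (is_zero M).
have [/P1//|indM] := pselect (indecomposable M).
have [A [B [iso nA nB]]] : exists A B : rmodType L,
    [/\ mod_iso M (A * B)%type, ~ is_zero A & ~ is_zero B].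
  apply: contrapT => nAB; apply: indM; split=> // A B iso.
  have [|nA] := pselect (is_zero A); [by left | right].
  by apply: contrapT => nB; apply: nAB; exists A, B.
have [f [g [fK gK]]] := mod_iso_inv iso.
have fgA : fin_gen A.
  by apply: (fin_gen_quot (p := fst \o f) (fgmod_fin_gen M)) => x;
    exists (g (x, 0)); rewrite /= gK.
have fgB : fin_gen B.
  by apply: (fin_gen_quot (p := snd \o f) (fgmod_fin_gen M)) => x;
    exists (g (0, x)); rewrite /= gK.
pose A' := FGMod fgA; pose B' := FGMod fgB.
have fl : flen M = (flen A' + flen B')%N.
  apply: (@flen_ses A' M B' (g \o pinl A B) (snd \o f)); split.
  - by move=> x y /= /(can_inj gK)[].
  - move=> y /=; split=> [fy|[x <-]]; last by rewrite gK.
    by exists (f y).1; rewrite -{2}[y]fK; case: (f y) fy => ? ? /= ->.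
  - by move=> x; exists (g (0, x)); rewrite /= gK.
have posA : (0 < flen A')%N by rewrite lt0n; apply/eqP => /flen0_zero.
have posB : (0 < flen B')%N by rewrite lt0n; apply/eqP => /flen0_zero.
apply: (PD A' B' M iso); apply: IHn; apply: leq_trans (ltMn : (_ <= n)%N);
  rewrite fl.
  by rewrite -[ltnLHS]addn0 ltn_add2l.
by rewrite -[ltnLHS]add0n ltn_add2r.
Qed.

Lemma add_of_indec U M :
  (forall X, indecomposable X -> is_summand X M -> add_of U X) -> add_of U M.
Proof.
move: M; apply: fg_ind.
- move=> M M0 _; apply/(add_ofP artinL).
  by exists 0, (fun=> \0), (fun=> \0) => z; rewrite big_ord0 [LHS]M0.
- move=> M indM; apply=> //.
  by apply: (@summand_retract _ _ _ idfun idfun).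
- move=> A B M /mod_iso_inv[f [g [fK gK]]] IHA IHB UM.
  have sA X : is_summand X A -> is_summand X M.
    move=> /retract_of_summand[a [b ba]].
    apply: (@summand_retract _ _ _ (g \o (pinl A B \o a)) (b \o (fst \o f))) =>
      x /=.
    by rewrite gK ba.
  have sB X : is_summand X B -> is_summand X M.
    move=> /retract_of_summand[a [b ba]].
    apply: (@summand_retract _ _ _ (g \o (pinr A B \o a)) (b \o (snd \o f))) =>
      x /=.
    by rewrite gK ba.
  apply: (@add_of_retract _ _ _ artinL U M (prodfg artinL A B) f g fK).
  apply: add_of_prod; [apply: IHA => X indX /sA | apply: IHB => X indX /sB];
    exact: UM.
Qed.

Lemma indec_add_retract U X : indecomposable X -> add_of U X ->
  exists (a : {linear X -> U}) (b : {linear U -> X}), bijective (b \o a).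
Proof.
move=> indX /(add_ofP artinL)[n [a [b e]]].
have bij_id : bijective (fun x : X => x) by exists id.
have [i bi] := local_sum indX bij_id (f := fun i => b i \o a i) e.
by exists (a i), (b i).
Qed.

(** An automorphism of [Y] through [U] is the sum of its components through the [X i]; locality
    makes one of them invertible. *)
Lemma indec_dirsum n (X : 'I_n -> fgmod L) U Y :
  is_dirsum (fun i => fgmod_sort (X i)) U -> (forall i, indecomposable (X i)) ->
  indecomposable Y -> add_of U Y -> exists i, mod_iso Y (X i).
Proof.
move=> [inj [proj [_ _ e]]] indX indY /(indec_add_retract indY)[a [b bij_ba]].
have [|i bi] := local_sum (f := fun i => (b \o inj i) \o (proj i \o a)) indY
  bij_ba.
  by move=> x /=; rewrite [a x in LHS]e linear_sum.
by exists i; apply: iso_of_retract bi; [case: indY | apply: indX].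
Qed.

Lemma indec_list M : exists n (X : 'I_n -> fgmod L),
  [/\ forall i, indecomposable (X i), forall i, add_of M (X i) &
    forall Y, indecomposable Y -> add_of M Y -> exists i, mod_iso Y (X i)].
Proof.
move: M; apply: fg_ind.
- move=> M M0; have noY Y : indecomposable Y -> ~ add_of M Y.
    move=> indY /(indec_add_retract indY)[a [b bb]]; case: indY => [[]] y.
    by apply: (bij_inj bb); rewrite /= !(M0 (a _)).
  by exists 0, (fun=> M); split=> [[]|[]|Y indY /(noY _ indY)].
- move=> M indM; exists 1, (fun=> M); split=> // [_|Y indY].
    exact: add_of_self artinL _.
  move=> /(indec_add_retract indY)[a [b bb]]; exists ord0.
  by apply: iso_of_retract bb => //; case: indY.
- move=> A B M /mod_iso_inv[f [g [fK gK]]] [n [X [indX aX XP]]] [m [Z [indZ aZ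
    ZP]]].
  exists (n + m)%N, (fun i => match fintype.split i with inl j => X j |
    inr j => Z j end).
  have aA : add_of M A.
    apply: (@add_of_retract _ _ _ artinL M A M (g \o pinl A B) (fst \o f)) =>
      [x|].
      by rewrite /= gK.
    exact: add_of_self artinL _.
  have aB : add_of M B.
    apply: (@add_of_retract _ _ _ artinL M B M (g \o pinr A B) (snd \o f)) =>
      [x|].
      by rewrite /= gK.
    exact: add_of_self artinL _.
  split=> [i|i|Y indY].
  + by case: (fintype.split i).
  + by case: (fintype.split i) => j; [apply: (add_of_trans artinL aA) |
      apply: (add_of_trans artinL aB)].
  move=> /(indec_add_retract indY)[a [b bb]].
  pose fA := (b \o (g \o pinl A B)) \o (fst \o (f \o a)).
  pose fB := (b \o (g \o pinr A B)) \o (snd \o (f \o a)).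
  have [q [bK qK]] := lin_inv bb.
  have retA N (c : {linear Y -> N}) (d : {linear N -> Y}) :
    bijective (d \o c) -> add_of N Y.
    move=> /lin_inv[r [dK _]].
    apply: (@add_of_retract _ _ _ artinL N Y N c (r \o d)); first exact: dK.
    exact: add_of_self artinL _.
  have [|bA|bB] := @local_sum2 Y (q \o fA) (q \o fB) indY.
  + move=> y; rewrite /= -linearD -linearD -linearD.
    rewrite -[RHS]bK /=; congr (q (b _)); rewrite -[RHS]fK; congr (g _).
    by case: (f (a y)) => u v; apply/pair_equal_spec; split;
      [apply: addr0|apply: add0r].
  + have [|i isoi] := XP Y indY; first exact: (retA _ _ (q \o (b \o (g \o pinl
      A B)))) bA.
    by exists (lshift m i); rewrite (unsplitK (inl i)).
  + have [|i isoi] := ZP Y indY; first exact: (retA _ _ (q \o (b \o (g \o pinr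
      A B)))) bB.
    by exists (rshift n i); rewrite (unsplitK (inr i)).
Qed.

(** Matching isomorphic summands injects each index set into the other; the resulting bijection
    assembles the isomorphisms. *)
Lemma basic_unique U V : basic U -> basic V -> add_of U = add_of V ->
  mod_iso U V.
Proof.
move=> [n [X [indX isoX DU]]] [m [Y [indY isoY DV]]] UV.
have /choice[s sP] i : exists j, mod_iso (X i) (Y j).
  apply: (indec_dirsum DV indY (indX i)); rewrite -UV.
  exact: (add_of_mem artinL i DU).
have /choice[t tP] j : exists i, mod_iso (Y j) (X i).
  apply: (indec_dirsum DU indX (indY j)); rewrite UV.
  exact: (add_of_mem artinL j DV).
have s_inj : injective s.
  move=> i j sij; apply/eqP/negP => /negP ij; apply: isoX ij _.
  by apply: mod_iso_trans (sP i) _; rewrite sij; apply: mod_iso_sym (sP j).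
have t_inj : injective t.
  move=> i j tij; apply/eqP/negP => /negP ij; apply: isoY ij _.
  by apply: mod_iso_trans (tP i) _; rewrite tij; apply: mod_iso_sym (tP j).
have s_bij : bijective s by apply: inj_card_bij s_inj (leq_card t t_inj).
have F i := cid (mod_iso_inv (sP i)).
have G i := cid (svalP (F i)).
have fK i := (svalP (G i)).1; have gK i := (svalP (G i)).2.
case: DU DV => [iU [pU [pU1 pU0 eU]]] [iV [pV [pV1 pV0 eV]]].
have lf : linear (fun u => \sum_i iV (s i) (sval (F i) (pU i u))).
  move=> c x y; rewrite scaler_sumr -big_split; apply: eq_bigr => i _.
  by rewrite !linearP.
have projUK (u : forall i, X i) i : pU i (\sum_j iU j (u j)) = u i.
  rewrite linear_sum (bigD1 i) //= pU1 big1 ?addr0 // => j ji; exact: pU0.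
have projVK (u : forall i, Y (s i)) i : pV (s i) (\sum_j iV (s j) (u j)) = u i.
  rewrite linear_sum (bigD1 i) //= pV1 big1 ?addr0 // => j ji; apply: pV0.
  by rewrite (inj_eq s_inj).
exists (lin_of lf); exists (fun v => \sum_i iU i (sval (G i) (pV (s i) v))) =>
  x /=.
  rewrite [RHS]eU; apply: eq_bigr => i _.
  by rewrite (projVK (fun j => sval (F j) (pU j x))) fK.
rewrite [RHS]eV (reindex s) /=; last exact: onW_bij.
apply: eq_bigr => i _.
by rewrite (projUK (fun j => sval (G j) (pV (s j) x))) gK.
Qed.

End KrullSchmidt.

(** * Existence of Ext-progenerators *)

Section Rigid.
Variables (R : comPzRingType) (L : pzRingType) (phi : {rmorphism R -> L}).
Hypothesis artinL : artin_algebra phi.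
Hypothesis heredL : hereditary L.
Implicit Types (U V M N X Y K I : fgmod L).

(* Happel-Ringel.  Let I be the image of f.  As Ext(Y/I, X) -> Ext(Y/I, I) is
   onto, the extension Y of Y/I by I is a pushout of some extension E of Y/I by
   X, whence an extension 0 -> X -> I + E -> Y -> 0, which splits.  As X is
   local, X -> I or X -> E splits. *)
Lemma hom_inj_or_surj X Y (f : {linear X -> Y}) :
  indecomposable X -> indecomposable Y -> Ext1_eq0 Y X ->
  (exists x, f x <> 0) -> injective f \/ surj f.
Proof.
move=> indX indY ext0 [x0 fx0].
have [I [p [i [sp inj_i ip]]]] := image_ex artinL f.
have sI : submod (im_sub i (fun _ => True)) by apply: submod_im.
have [Z [c [sc cP]]] := quotient_fg sI.
have ex_c y : c y = 0 <-> exists w, i w = y.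
  by rewrite -cP; split=> [[w _ <-]|[w <-]]; exists w.
have [K [P [k [q [[inj_k ex_k sq] projK hP _]]]]] :=
  presentation_ex artinL heredL Z.
have [l lP] := hereditary_mod_projective hP q sc.
have [h hE] : exists h : {linear K -> I}, forall z, i (h z) = l (k z).
  apply: (factor_inj (f := l \o k)) => // z; apply/ex_c; rewrite lP.
  by apply/ex_k; exists z.
(* [h] represents [Y] as an extension of [Z] by [I]; since the syzygy [K] is projective, it lifts
   along [p], so the class comes from an extension by [X]. *)
have [h' h'E] := projK _ _ p h sp.
have kq : short_exact k q by [].
have [E [eX [eP [g [[inj_eX _ _] eK _ Eex univ]]]]] := pushout_ex h' kq.
have [w|t [tX tP]] := univ Y f l; first by rewrite -ip h'E hE.
have la : linear (fun x => (p x, - eX x)).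
  move=> a x y; apply/pair_equal_spec; split; first exact: linearP.
  exact: (linearP (GRing.opp \o eX)).
have lb : linear (fun z : I * E => i z.1 + t z.2).
  by move=> a x y; rewrite !linearP scalerDr addrACA.
have se' : short_exact (lin_of la) (lin_of lb).
  split.
  - apply: inj_lin0 => x /= [_ /eqP]; rewrite oppr_eq0 -(linear0 eX) => /eqP.
    exact: inj_eX.
  - move=> [w v]; split=> [|[x [<- <-]]] /=; last first.
      by rewrite linearN tX ip subrr.
    have [x [y ->]] := Eex v; rewrite linearD tX tP => iwE.
    have /ex_k[u uE] : q y = 0.
      rewrite -lP; have := congr1 c iwE; rewrite !linearD linear0.
      have -> : c (i w) = 0 by apply/ex_c; exists w.
      have -> : c (f x) = 0 by apply/ex_c; exists (p x).
      by rewrite !add0r.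
    exists (- (x + h' u)); rewrite -uE eK -linearD /=; congr pair.
      apply: inj_i; rewrite linearN linearN linearD linearD h'E hE uE ip.
      by apply/eqP; rewrite eq_sym -addr_eq0 iwE.
    by rewrite linearN opprK.
  - move=> y; have [u uE] := sq (c y).
    have /ex_c[w wE] : c (y - l u) = 0 by rewrite linearB lP uE subrr.
    by exists (w, eP u); rewrite /= tP wE subrK.
have [r rP] := Ext1_extend idfun ext0 se'.
pose al : {linear X -> X} := (r \o pinl I E) \o p.
pose be : {linear X -> X} := (r \o pinr I E) \o (GRing.opp \o eX).
have [|bij_al|bij_be] := @local_sum2 _ _ _ artinL X al be indX.
- move=> x; rewrite -[RHS](rP x) /= -linearD; congr (r _).
  by apply/pair_equal_spec; split; [apply: addr0 | apply: add0r].
- left=> x y fxy; apply: (bij_inj bij_al); congr (r (pinl _ _ _)).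
  by apply: inj_i; rewrite !ip.
right; have [b [beK _]] := lin_inv bij_be.
have [rho rhoK] : exists rho : {linear E -> X}, forall x, rho (eX x) = x.
  by exists (b \o ((r \o pinr I E) \o GRing.opp)) => x; apply: beK.
(* If [X -> E] splits, so does its pushout [i]: [Y] is a quotient of [I * P], and a retraction [s]
   onto [I] is defined there as the identity on [I] and [p \o rho \o eP] on [P]. *)
have lg : linear (fun z : I * P => i z.1 + l z.2).
  by move=> a x y; rewrite !linearP scalerDr addrACA.
have ls : linear (fun z : I * P => z.1 + p (rho (eP z.2))).
  by move=> a x y; rewrite !linearP scalerDr addrACA.
have [s sP] : exists s : {linear Y -> I}, forall z,
  s (lin_of lg z) = lin_of ls z.
  apply: factor_surj => [y|[w y]] /=.
    have [u uE] := sq (c y).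
    have /ex_c[w wE] : c (y - l u) = 0 by rewrite linearB lP uE subrr.
    by exists (w, u); rewrite /= wE subrK.
  move=> iwE; have /ex_k[u uE] : q y = 0.
    rewrite -lP; have := congr1 c iwE; rewrite linearD linear0.
    have -> : c (i w) = 0 by apply/ex_c; exists w.
    by rewrite add0r.
  rewrite -uE [X in rho X]eK rhoK h'E; apply: inj_i.
  by rewrite linearD linear0 hE uE.
have si w : s (i w) = w.
  by have := sP (w, 0); rewrite /= !linear0 !addr0.
have ld : linear (fun y => y - i (s y)).
  by move=> a x y; rewrite !linearP addrACA scalerDr.
(* Either [i \o s] is invertible and [f] is onto, or [1 - i s] is invertible although it kills the
   nonzero image of [f]. *)
have [|[v _ vK]|bij_d] := @local_sum2 _ _ _ artinL Y (i \o s) (lin_of ld) indY.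
- by move=> y /=; rewrite addrC subrK.
- move=> y; have [x xE] := sp (s (v y)); exists x.
  by rewrite -ip xE; apply: vK.
case: fx0; rewrite -ip -(linear0 i); congr (i _); apply: inj_i.
by apply: (bij_inj bij_d); rewrite /= !si !subrr.
Qed.

Lemma homlen0 X Y : homlen phi X Y = 0%N -> forall (f : {linear X -> Y}) x,
  f x = 0.
Proof.
move=> h0 f x; have lf : homs (phi := phi) (f : X -> Y) by apply: linearP.
have f0 : (f : X -> res Y phi) = 0.
  apply: (@len_eq _ _ (@homs _ _ phi X Y) (fun g => g = 0)) lf.
  - exact: finlen_homs.
  - by split=> // a u v -> ->; rewrite scaler0 addr0.
  - move=> _ ->; exact: (submod0 (submod_homs artinL X Y)).
  - by rewrite -/(homlen phi X Y) h0.
by rewrite [f x](congr1 (fun g => g x) f0).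
Qed.

Lemma homlen_zero X Y : is_zero X -> homlen phi X Y = 0%N.
Proof.
move=> X0; apply: len0 => f lf; apply/funext => x.
by rewrite (X0 x); apply: (linear0 (lin_of lf)).
Qed.

Lemma homlen_iso X X' Y : mod_iso X X' -> homlen phi X Y = homlen phi X' Y.
Proof.
case/mod_iso_inv=> f [g [fK gK]]; have [Z Z0] := zero_ex artinL.
rewrite (@homlen_exact _ _ _ artinL Z X X' Y \0 f).
- by rewrite (homlen_zero Y Z0) addn0.
- move=> x; split=> [fx|[z <-]]; last exact: linear0.
  by exists 0; apply: (can_inj fK); rewrite fx !linear0.
- by move=> x; exists (g x).
- by move=> h; exists \0 => z; rewrite (Z0 z) !linear0.
Qed.

Lemma homlen_prod A B Y :
  homlen phi (prodfg artinL A B) Y = (homlen phi A Y + homlen phi B Y)%N.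
Proof.
rewrite addnC (@homlen_exact _ _ _ artinL A (prodfg artinL A B) B Y (pinl A B)
  snd) //.
- move=> [x y]; split=> [/= ->|[z [_ <-]] //]; by exists x.
- by move=> y; exists (0, y).
- by move=> h; exists (h \o fst).
Qed.

Lemma projective_add_of X : projective X -> add_of (regfg L) X.
Proof.
move=> projX; have [F [p [_ aF sp]]] := cover_ex artinL heredL X.
have [s sP] := projX _ _ p idfun sp.
exact: (add_of_retract artinL (a := s) (b := p) sP aF).
Qed.

(* The classes of the X i in the Grothendieck group of projectives are
   independent: by the Happel-Ringel lemma the quiver of nonzero maps between
   the X i is acyclic, so that the matrix of the lengths of Hom(X i, X j) is
   invertible. *)
Lemma rigid_family_bound : exists m, forall n (X : 'I_n -> fgmod L),
  (forall i, indecomposable (X i)) ->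
  (forall i j, i != j -> ~ mod_iso (X i) (X j)) ->
  (forall i j, Ext1_eq0 (X i) (X j)) -> (n <= m)%N.
Proof.
have [m [P [indP _ projP]]] := indec_list artinL (regfg L).
exists m => n X indX isoX extX.
(* [a] is the class of [M] in the Grothendieck group of projectives; what matters is that it does
   not depend on [Y]. *)
have coef M : add_of (regfg L) M -> exists a : 'I_m -> nat,
    forall Y, homlen phi M Y = (\sum_k a k * homlen phi (P k) Y)%N.
  move: M; apply: (fg_ind artinL).
  - move=> M M0 _; exists (fun=> 0) => Y.
    by rewrite (homlen_zero Y M0) big1 // => k _; rewrite mul0n.
  - move=> M indM /(projP _ indM)[k iso]; exists (fun l => (l == k)%N : nat) =>
      Y.
    rewrite (homlen_iso Y iso) (bigD1 k) //= eqxx mul1n big1 ?addn0 // => l lk.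
    by rewrite (negPf lk).
  - move=> A B M isoM IHA IHB aM; have [f [g [fK gK]]] := mod_iso_inv isoM.
    have [|a aE] := IHA.
      apply: (@add_of_retract _ _ _ artinL _ A M (g \o pinl A B) (fst \o f)) aM
        => x /=.
      by rewrite gK.
    have [|b bE] := IHB.
      apply: (@add_of_retract _ _ _ artinL _ B M (g \o pinr A B) (snd \o f)) aM
        => x /=.
      by rewrite gK.
    exists (fun k => a k + b k)%N => Y.
    rewrite (@homlen_iso M (prodfg artinL A B) Y isoM) homlen_prod aE bE
      -big_split.
    by apply: eq_bigr => k _; rewrite mulnDl.
(* The class of [X i] is [[F] - [K]]; the pair keeps both terms because lengths are natural
   numbers. *)
have coefX i : exists a : 'I_m -> nat * nat, forall j,
    (homlen phi (X i) (X j) + \sum_k (a k).2 * homlen phi (P k) (X j) =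
     \sum_k (a k).1 * homlen phi (P k) (X j))%N.
  have [K [F [k [q [[inj_k ex_k sq] projK _ aF]]]]] :=
    presentation_ex artinL heredL (X i).
  have [a aE] := coef F aF; have [b bE] := coef K (projective_add_of projK).
  exists (fun k => (a k, b k)) => j; rewrite -aE -bE.
  rewrite (homlen_exact artinL ex_k sq) // => h.
  by apply: (Ext1_extend h (extX i j)); split; [exact: inj_k|exact: ex_k|exact:
    sq].
have /choice[a aE] := coefX.
pose G : 'M[rat]_n := \matrix_(i, j) (homlen phi (X i) (X j))%:R.
pose A : 'M[rat]_(n, m) := \matrix_(i, k) ((a i k).1%:R - (a i k).2%:R).
pose H : 'M[rat]_(m, n) := \matrix_(k, j) (homlen phi (P k) (X j))%:R.
have GAH : G = A *m H.
  apply/matrixP => i j; rewrite !mxE.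
  have /(congr1 (fun x => x%:R : rat)) := aE i j.
  rewrite natrD !natr_sum => /eqP; rewrite eq_sym -subr_eq => /eqP <-.
  rewrite -sumrB; apply: eq_bigr => k _; by rewrite !mxE mulrBl -!natrM.
suff : row_free G.
  rewrite /row_free GAH => /eqP <-.
  exact: leq_trans (mxrankM_maxl _ _) (rank_leq_col _).
apply: inj_row_free => c cG; apply/eqP/contraT => c0.
pose T0 := [set j | c 0 j != 0].
(* A set where each vertex has another vertex of the set as predecessor contains an oriented cycle
   of nonzero maps. A minimal such set takes the place of the cycle. *)
pose pred_closed (T : {set 'I_n}) := (T != set0) &&
  [forall v in T, exists u in T, (u != v) && (homlen phi (X u) (X v) != 0)]%N.
(* Without a predecessor of [v] in the support of [c], the entry of [c *m G] at [v] would be [c 0 v]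
   times the nonzero length of End(X v). *)
have hasT0 : pred_closed T0.
  apply/andP; split.
    have [j cj] := rV0Pn _ c0.
    by apply/set0Pn; exists j; rewrite inE.
  apply/forall_inP => v; rewrite inE => cv; apply: contraT => /exists_inPn nu.
  have := congr1 (fun B : 'rV[rat]_n => B 0 v) cG;
    rewrite mxE [RHS]mxE (bigD1 v) //= big1 => [|u uv].
    move/eqP; rewrite addr0 mulf_eq0 (negPf cv) /= mxE Num.Theory.pnatr_eq0 =>
      /eqP/homlen0/(_ idfun) id0.
    by case: (indX v) => -[].
  have [->|cu] := eqVneq (c 0 u) 0; first by rewrite mul0r.
  have := nu u; rewrite inE => /(_ cu); rewrite uv negbK => /eqP h0.
  by rewrite mxE h0 mulr0.
have [T minT _] := minset_exists hasT0.
have /andP[T_n0 /forall_inP predT] := minsetp minT.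
(* If [v] had no successor in [T], removing [v] would leave a smaller set of the same kind. *)
have succT v : v \in T -> exists2 w, w \in T & (w != v) && (homlen phi (X v) (X
  w) != 0)%N.
  move=> vT; apply: contrapT => nw.
  have [u uT /andP[uv _]] := exists_inP (predT v vT).
  have : T :\ v = T.
    apply: (minsetinf minT); last exact: subD1set.
    apply/andP; split; first by apply/set0Pn; exists u; rewrite in_setD1 uv.
    apply/forall_inP => w; rewrite in_setD1 => /andP[wv wT].
    have [x xT /andP[xw hx]] := exists_inP (predT w wT).
    apply/exists_inP; exists x; last by rewrite xw.
    rewrite in_setD1 xT andbT; apply/eqP => xv; apply: nw; exists w => //.
    by rewrite wv -xv.
  by move/setP/(_ v); rewrite in_setD1 eqxx vT.
have [v0 v0T] := set0Pn _ T_n0.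
(* At a vertex of minimal length an incoming map cannot be injective and an outgoing one cannot be
   surjective. So [f] is onto and [g] injective, and the nonzero composite is neither, against
   [hom_inj_or_surj]. *)
case: (arg_minnP (fun v => flen phi (X v)) v0T) => v vT minv.
have [u uT /andP[uv huv]] := exists_inP (predT v vT).
have [w wT /andP[wv hvw]] := succT v vT.
have nz i j : homlen phi (X i) (X j) != 0%N ->
    exists (f : {linear X i -> X j}), exists x, f x <> 0.
  move=> h; apply: contrapT => nf; case/negP: h; apply/eqP; apply: len0 => f lf.
  apply/funext => x; apply: contrapT => fx; apply: nf.
  by exists (lin_of lf), x.
have [f fn0] := nz _ _ huv; have [g [z gz]] := nz _ _ hvw.
have nuv : ~ mod_iso (X u) (X v) by apply: isoX.
have nvw : ~ mod_iso (X v) (X w) by apply: isoX; rewrite eq_sym.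
have [inj_f|sf] := hom_inj_or_surj (indX u) (indX v) (extX v u) fn0.
  by case: nuv; exists f; apply: (flen_inj_bij artinL inj_f); apply: minv.
have [inj_g|sg] : injective g \/ surj g.
  by apply: (hom_inj_or_surj (indX v) (indX w) (extX w v)); exists z.
  have [x xz] := sf z.
  have [|inj_gf|sgf] := hom_inj_or_surj (f := g \o f) (indX u) (indX w) (extX w
    u).
  - by exists x; rewrite /= xz.
  - case: nuv; exists f; apply: inj_surj_bij => // x1 x2 e12.
    by apply: inj_gf; rewrite /= e12.
  - case: nvw; exists g; apply: inj_surj_bij => // y.
    by have [x' <-] := sgf y; exists (f x').
by case: nvw; exists g; apply: (flen_surj_bij artinL sg); apply: minv.
Qed.

(** * The basic progenerator as the sum of all indecomposable Ext-projectives *)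

Lemma ext_projective_add (C : subcat L) U M : subcategory C ->
  ext_projective C U -> add_of U M -> ext_projective C M.
Proof.
move=> [_ dsC smC] [CU ext0] aM; split; last first.
  by move=> Y /ext0; apply: Ext1_add_l artinL _ _ _ aM.
by have [n [T [/dsC CT /smC]]] := aM; apply; apply: CT.
Qed.

(** A family of indecomposable Ext-projectives of maximal size exists by [rigid_family_bound]; any
    indecomposable Ext-projective not isomorphic to a member could be adjoined. *)
Lemma progenerator_ex (C : subcat L) : subcategory C ->
  enough_ext_projectives C ->
  exists U, basic U /\ ext_progenerator C U.
Proof.
move=> subC enC; have [m mP] := rigid_family_bound.
pose Fam n := exists X : 'I_n -> fgmod L, [/\ forall i, indecomposable (X i),
  forall i j, i != j -> ~ mod_iso (X i) (X j) & forall i,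
    ext_projective C (X i)].
have exF : exists n, `[<Fam n>].
  by exists 0; apply/asboolP; exists (fun=> regfg L); split=> [[]|[]|[]].
have ubF n : `[<Fam n>] -> (n <= m)%N.
  move/asboolP=> [X [indX isoX pX]]; apply: (mP n X) => // i j.
  by have [_] := pX i; apply; case: (pX j).
case: (ex_maxnP exF ubF) => n /asboolP[X [indX isoX pX]] maxn.
have [U DU] := dirsum_ex artinL X.
have CU : C U.
  by case: subC => _ dsC _; apply: (dsC n X) => // i; case: (pX i).
have pU : ext_projective C U.
  split=> // Y CY; have UU : add_of U U := add_of_self artinL U.
  apply/Ext1_sectionP => E i p ip; case: (DU) => inj [proj [p1 p0 e]].
  have lift k : exists v : {linear X k -> E}, forall x, p (v x) = inj k x.
    by apply: (Ext1_lift _ _ ip); case: (pX k) => _; apply.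
  pose v k := sval (cid (lift k)).
  have lf : linear (fun m => \sum_k v k (proj k m)).
    move=> c x y; rewrite scaler_sumr -big_split; apply: eq_bigr => k _.
    by rewrite !linearP.
  exists (lin_of lf) => x; rewrite [RHS]e linear_sum.
  by apply: eq_bigr => k _; rewrite /v; case: cid.
exists U; split; first by exists n, X.
split=> //; apply/funext => M; apply/propext; split.
  exact: ext_projective_add.
move=> [CM ext0]; apply: (add_of_indec artinL) => Y indY sYM.
have pY : ext_projective C Y.
  have aY : add_of M Y.
    have [a [b ba]] := retract_of_summand sYM.
    by apply: (add_of_retract artinL ba); apply: add_of_self artinL _.
  exact: (ext_projective_add subC _ aY).
have [[i iso]|nY] := pselect (exists i, mod_iso (X i) Y).
  have [f [g [fK gK]]] := mod_iso_inv iso.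
  exact: (add_of_retract artinL gK (add_of_mem artinL i DU)).
have : `[<Fam n.+1>]; last by move/maxn; rewrite ltnn.
apply/asboolP; exists (fun i => if unlift ord0 i is Some j then X j else Y);
  split.
- by move=> i; case: unliftP.
- move=> i j; case: unliftP => [i'|] ->; case: unliftP => [j'|] ->.
  + by rewrite (inj_eq lift_inj); apply: isoX.
  + by move=> _ iso; apply: nY; exists i'.
  + by move=> _ /mod_iso_sym iso; apply: nY; exists j'.
  + by rewrite eqxx.
- by move=> i; case: unliftP.
Qed.

End Rigid.

(** * Left approximations and representation-finite algebras *)

Section EnoughProjectives.
Variables (R : comPzRingType) (L : pzRingType) (phi : {rmorphism R -> L}).
Hypothesis artinL : artin_algebra phi.
Hypothesis heredL : hereditary L.
Implicit Types (U V M N X Y K I W : fgmod L).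

Definition left_approx (C : subcat L) W C0 (g : {linear W -> fgmod_sort C0}) :=
  C C0 /\ forall N (h : {linear W -> N}), C N ->
    exists t : {linear C0 -> N}, forall x, t (g x) = h x.

Lemma left_approx_add W M : exists (C0 : fgmod L) (g : {linear W -> C0}),
  add_of M C0 /\ forall N (h : {linear W -> N}), add_of M N ->
    exists t : {linear C0 -> N}, forall x, t (g x) = h x.
Proof.
have [n [h hP]] := hom_fin_gen artinL W M.
have [A D] := dirsum_ex artinL (fun _ : 'I_n => M).
have aA : add_of M A.
  by apply: (add_of_dirsum artinL D) => _; apply: add_of_self artinL _.
have [inj [proj [p1 p0 e]]] := D.
have lg : linear (fun x => \sum_i inj i (h i x)).
  move=> c x y; rewrite scaler_sumr -big_split; apply: eq_bigr => i _.
  by rewrite !linearP.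
have facM (u : {linear W -> M}) : exists t : {linear A -> M},
    forall x, t (lin_of lg x) = u x.
  have [c uE] := hP u.
  have lt0 : linear (fun z => \sum_i phi_scale artinL M (c i) (proj i z)).
    move=> a x y; rewrite scaler_sumr -big_split; apply: eq_bigr => i _.
    by rewrite !linearP.
  exists (lin_of lt0) => x; rewrite uE; apply: eq_bigr => i _ /=.
  congr (_ *: _); rewrite linear_sum (bigD1 i) //= p1 big1 ?addr0 // => j ji.
  exact: p0.
exists A, (lin_of lg); split=> // N u /(add_ofP artinL)[m [a [b eN]]].
have /choice[t tP] j := facM (a j \o u).
have lt0 : linear (fun z => \sum_j b j (t j z)).
  move=> c x y; rewrite scaler_sumr -big_split; apply: eq_bigr => i _.
  by rewrite !linearP.
exists (lin_of lt0) => x; rewrite [RHS]eN; apply: eq_bigr => j _.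
by rewrite tP.
Qed.

(** Take an approximation of least length. If [s] fixes [g], then [g] factors through the Fitting
    image of [s], a summand of [C0] that is again an approximation, hence has full length. *)
Lemma left_minimal_approx (C : subcat L) W : subcategory C ->
  (exists C0 (g : {linear W -> fgmod_sort C0}), left_approx C g) ->
  exists C0 (g : {linear W -> fgmod_sort C0}), left_approx C g /\
    forall s : {linear C0 -> C0}, (forall x, s (g x) = g x) -> bijective s.
Proof.
move=> [_ _ smC] exg.
pose T l := exists C0 (g : {linear W -> fgmod_sort C0}),
  left_approx C g /\ flen phi C0 = l.
have exT : exists l, `[<T l>].
  by have [C0 [g ag]] := exg; exists (flen phi C0); apply/asboolP; exists C0, g.
case: (ex_minnP exT) => l /asboolP[C0 [g [[CC0 ag] <-]]] minl.
exists C0, g; split=> // s sg.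
have [n [I [p [i [sp inj_i ip bij_pi]]]]] := fitting_image artinL s.
have ipg x : i (p (g x)) = g x by rewrite ip; elim: n.+1 => //= k ->.
have [q [piK _]] := lin_inv bij_pi.
have CI : C I.
  apply: (smC _ _ CC0); apply: (@summand_retract _ _ _ i (q \o p)).
  exact: piK.
have aI : left_approx C (p \o g).
  split=> // N h CN; have [t tP] := ag N h CN; exists (t \o i) => x /=.
  by rewrite ipg tP.
have bij_p : bijective p.
  apply: (flen_surj_bij artinL sp); apply: minl; apply/asboolP.
  by exists I, (p \o g).
apply: (flen_inj_bij artinL) => //; apply: inj_lin0 => x sx.
apply: (bij_inj bij_p); apply: inj_i; rewrite ip iterSr sx linear0 linear0.
exact: (linear0 (lin_of (linear_iter s n))).
Qed.

(* Push out a presentation of X along a minimal left C-approximation of the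
   syzygy of X: the middle term is Ext-projective in C. *)
Lemma enough_of_left_approx (C : subcat L) : subcategory C -> ext_closed C ->
  (forall W, exists C0 (g : {linear W -> fgmod_sort C0}), left_approx C g) ->
  enough_ext_projectives C.
Proof.
move=> subC extC lapp X CX.
have [W [F [w [p [wp projW hF _]]]]] := presentation_ex artinL heredL X.
have [C0 [g [[CC0 ag] ming]]] := left_minimal_approx subC (lapp W).
have [E [l [m [v [lv mw vm Elm univ]]]]] := pushout_ex g wp.
have ex_lv : exact_at l v by case: lv.
pose E' := FGMod (fin_gen_ses artinL ex_lv).
have CE : C E' by apply: (extC C0 E' X l v).
exists C0, E', l, v; split=> //; split=> // Y CY.
apply/Ext1_sectionP => Q j q jq.
case: (jq) (lv) (wp) => inj_j ex_j sq [inj_l _ sv] [inj_w ex_w sp].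
pose Q' := FGMod (fin_gen_ses artinL (ex_j : exact_at (j : {linear Y ->
  Q}) (q : {linear Q -> E'}))).
have [u uP] := hereditary_mod_projective hF m sq.
(* [F0] is the preimage of [C0] in [Q], an extension of [C0] by [Y] and so an object of [C], to
   which maps from [W] extend over [C0]. *)
have [F0 [k [inj_k ex_k]]] := @kernel_ex _ _ _ artinL Q' X (v \o q).
have [r rP] : exists r : {linear F0 -> C0}, forall z, l (r z) = q (k z).
  apply: (factor_inj (f := q \o k)) => // z; apply/ex_lv.
  by apply/ex_k; exists z.
have vl c : v (l c) = 0 by apply/ex_lv; exists c.
have qj y : q (j y) = 0 by apply/ex_j; exists y.
have [jF jFP] : exists jF : {linear Y -> F0}, forall y, k (jF y) = j y.
  by apply: factor_inj => // y; apply/ex_k; rewrite /= qj linear0.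
have CF0 : C F0.
  apply: (extC Y F0 C0 jF r) => //; split.
  - by move=> x y /(congr1 k); rewrite !jFP => /inj_j.
  - move=> z; split=> [rz|[y <-]].
      have /ex_j[y yE] : q (k z) = 0 by rewrite -rP rz linear0.
      by exists y; apply: inj_k; rewrite jFP.
    by apply: inj_l; rewrite rP jFP qj linear0.
  - move=> c; have [z zE] := sq (l c).
    have /ex_k[y yE] : (v \o q) z = 0 by rewrite /= zE vl.
    by exists y; apply: inj_l; rewrite rP yE.
have pw x : p (w x) = 0 by apply/ex_w; exists x.
have [h hP] : exists h : {linear W -> F0}, forall x, k (h x) = u (w x).
  apply: (factor_inj (f := u \o w)) => // x; apply/ex_k.
  by rewrite /= uP vm pw.
have [s sP] := ag F0 h CF0.
(* With the inverse [t] of [r \o s], the map [k \o s \o t] on [C0] agrees with [u] on [W]; both glue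
   to a section on the pushout [E]. *)
have /ming/lin_inv[t [tK Kt]] : forall x, (r \o s) (g x) = g x.
  by move=> x; apply: inj_l; rewrite /= rP sP hP uP mw.
have tg x : t (g x) = g x.
  have {2}<- := tK (g x); congr (t _); apply: inj_l.
  by rewrite /= rP sP hP uP mw.
have [x|z [zl zm]] := univ Q (k \o (s \o t)) u.
  by rewrite /= tg sP hP.
exists z => e; have [c [x ->]] := Elm e.
rewrite !linearD zl zm uP /=; congr (_ + _).
by rewrite -rP; congr (l _); apply: Kt.
Qed.

(** [C] is [add M] for the sum [M] of the representatives [X i] lying in [C]; the others are
    replaced by a zero module so that the index set stays the same. *)
Lemma rep_finite_left_approx (C : subcat L) : rep_finite L -> subcategory C ->
  forall W, exists C0 (g : {linear W -> fgmod_sort C0}), left_approx C g.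
Proof.
move=> [n [X XP]] subC W; have [isoC dsC smC] := subC.
have [Z Z0] := zero_ex artinL.
have CZ : C Z.
  apply: (dsC 0 (fun=> Z)) => [[]//|]; exists (fun=> \0), (fun=> \0).
  by split=> [[]|[]|z]; rewrite // big_ord0 [LHS]Z0.
pose Y i := if pselect (C (X i)) then X i else Z.
have CY i : C (Y i) by rewrite /Y; case: pselect.
have [M DM] := dirsum_ex artinL Y.
have CM : C M by apply: dsC DM.
have [C0 [g [aC0 gP]]] := left_approx_add W M; exists C0, g; split.
  by have [k [T [/dsC CT /smC]]] := aC0; apply; apply: CT.
move=> N h CN; apply: gP; apply: (add_of_indec artinL) => V indV sVN.
have [i isoV] := XP V indV.
have CXi : C (X i) by apply: isoC isoV; apply: smC sVN.
have aX : add_of M (X i).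
  by have := add_of_mem artinL i DM; rewrite /Y; case: pselect.
have [f [f' [fK _]]] := mod_iso_inv isoV.
exact: (add_of_retract artinL fK aX).
Qed.

Lemma rep_finite_enough (C : subcat L) : rep_finite L -> subcategory C ->
  ext_closed C -> enough_ext_projectives C.
Proof.
move=> rf subC extC; apply: enough_of_left_approx => //.
exact: rep_finite_left_approx.
Qed.

Lemma is_dirsum_iso (S : pzRingType) n (X : 'I_n -> lmodType S) (M N :
  lmodType S) :
  mod_iso M N -> is_dirsum X M -> is_dirsum X N.
Proof.
case/mod_iso_inv=> f [g [fK gK]] [inj [proj [p1 p0 e]]].
exists (fun i => f \o inj i), (fun i => proj i \o g).
split=> [i x|i j ij x|m] /=; rewrite ?fK ?p1 ?p0 //.
by rewrite -linear_sum -e gK.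
Qed.

Lemma progen_class_eq (C : subcat L) U : subcategory C ->
  basic U -> ext_progenerator C U -> progen_class C = iso_class U.
Proof.
move=> [isoC _ _] bU gU; apply/funext => V; apply/propext; split.
  move=> [bV [_ aV _]]; apply: (basic_unique artinL bU bV).
  by rewrite aV; case: gU.
move=> isoUV; split.
  have [n [X [indX isoX DU]]] := bU; exists n, X; split=> //.
  exact: is_dirsum_iso DU.
have [CU aU enC] := gU; split=> //; first exact: isoC isoUV.
rewrite -aU; apply/funext => M; apply/propext; split; apply: add_of_iso => //.
exact: mod_iso_sym.
Qed.

End EnoughProjectives.

Theorem theorem2p3 (R : comPzRingType) (L : pzRingType)
    (phi : {rmorphism R -> L})
    (artinL : artin_algebra phi) (heredL : hereditary L) :
  [/\ (forall K : subcat L, rigid_classes K -> ice_p (cok_class K)),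
      (forall C : subcat L, ice_p C -> rigid_classes (progen_class C)),
      (forall K : subcat L, rigid_classes K -> progen_class (cok_class K) = K),
      (forall C : subcat L, ice_p C -> cok_class (progen_class C) = C)
    & (rep_finite L ->
         (forall C : subcat L, ce C -> ice C) /\
         @ice_p L = @ice L)].
Proof.
have progen (C : subcat L) : ice_p C -> exists U : fgmod L,
    [/\ basic U, ext_progenerator C U & progen_class C = iso_class U].
  move=> [[subC _ _ _] enC].
  have [U [bU gU]] := progenerator_ex artinL heredL subC enC.
  by exists U; split=> //; apply: (progen_class_eq artinL).
split.
- move=> _ [U [bU rU ->]]; rewrite cok_class_iso.
  exact: (cok_ice_p artinL heredL rU).
- move=> C /progen[U [bU gU ->]]; exists U; split=> //.
  exact: (progenerator_rigid artinL gU).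
- move=> _ [U [bU rU ->]]; rewrite cok_class_iso.
  apply: (progen_class_eq artinL (cok_subcategory artinL heredL rU) bU).
  exact: (cok_progenerator artinL heredL rU).
- move=> C iceC; have [U [bU gU ->]] := progen C iceC.
  rewrite cok_class_iso; apply: (progenerator_cok _ gU).
  by case: iceC => [[]].
- move=> rf; have enough (C : subcat L) : ce C -> enough_ext_projectives C.
    by move=> [subC _ extC]; apply: (rep_finite_enough artinL heredL).
  split=> [C ceC|].
    have [subC cokC _] := ceC.
    have [U [_ gU]] := progenerator_ex artinL heredL subC (enough C ceC).
    rewrite -(progenerator_cok cokC gU).
    by case: (cok_ice_p artinL heredL (progenerator_rigid artinL gU)).
  apply/funext => C; apply/propext; split=> [[]//|iceC]; split=> //.
  by apply: enough; case: iceC.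
Qed.
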